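(* Let $\Lambda=(e_{FS},c_F,c_S)\in(0,\infty)^3$, let $p,q\in\mathbb N$ be co-prime, $z=(p,q,0)$, and let $x_F\in\mathbb R^2\setminus\overline S$ be such that $\mathrm{dist}(\partial\mathcal L_F,\partial\mathcal L_S)\ge e_{FS}$ and $x_F\in\partial\mathcal L_{FS}$. Let $C_1,\dots,C_4$ be the classes of models defined in the context, and let $s$ be the integer in the definition of $C_4$ when $\mathcal M_\Lambda(x_F,z)\in C_4$. Assume the dewetting condition $$ \begin{cases} c_S< 6c_F & \text{if either } \mathcal M_\Lambda(x_F,z)\in C_1\cup C_2 \text{ and } q>1,\ \text{or } \mathcal M_\Lambda(x_F,z)\in C_3 \text{ and } q>2,\\ & \text{or } \mathcal M_\Lambda(x_F,z)\in C_4 \text{ and } 1<s<q-1,\\ c_S< 5c_F & \text{if } \mathcal M_\Lambda(x_F,z)\in C_4 \text{ and } s=1 \text{ or } s=q-1,\\ c_S< 4c_F & \text{if either } \mathcal M_\Lambda(x_F,z)\in C_1\cup C_2 \text{ and } q=1,\ \text{or } \mathcal M_\Lambda(x_F,z)\in C_3 \text{ and } q=2. \end{cases} $$ If $\widehat D_n\in\mathcal C_n$ are minimizers of $V_n$ among all crystalline configurations in $\mathcal C_n$, i.e. $V_n(\widehat D_n)=\min_{D_n\in\mathcal C_n}V_n(D_n)$, and we select for every $\widehat D_n$ a connected component $\widehat D_{n,1}\subset\widehat D_n$ with largest cardinality, then $$\lim_{n\to\infty}\mu_{\widehat D_n}\big(n^{-1/2}\widehat D_{n,1}\big)=1,$$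 i.e. $\lim_{n\to\infty}\#\widehat D_{n,1}/n=1$, where $\mu_{\widehat D_n}$ is the empirical measure associated to $\widehat D_n$.
   Context: $\mathbb N=\{1,2,\dots\}$. $S:=\mathbb R\times(-\infty,0)$ with closure $\overline S$; $\boldsymbol t_1:=(1,0)$, $\boldsymbol t_2:=\tfrac12(1,\sqrt3)$. Model $\mathcal M_\Lambda(x_F,z)$, for $z=(p,q,0)$ with $p,q\in\mathbb N$ co-prime, $x_F\in\mathbb R^2\setminus\overline S$, $\Lambda=(e_{FS},c_F,c_S)\in(0,\infty)^3$. Substrate wall: $\partial\mathcal L_S:=\{(k/p,0):k\in q\mathbb Z\}$. Film lattice: $\mathcal L_F:=\{x_F+k_1\boldsymbol t_1+k_2\boldsymbol t_2: k_1\in\mathbb Z,\ k_2\in\mathbb N\cup\{0\}\}$; its lower boundary: $\partial\mathcal L_F:=\{x_F+k_1\boldsymbol t_1:k_1\in\mathbb Z\}$; and $\partial\mathcal L_{FS}:=\{x\in\partial\mathcal L_F:\mathrm{dist}(x,\partial\mathcal L_S)=e_{FS}\}$. A substrate neighbor of a site $x\in\mathcal L_F$ is an element of $\partial\mathcal L_S$ at distance exactly $e_{FS}$ from $x$. Potentials: for $\alpha\in\{F,S\}$, with $e_{FF}:=1$, $v_{F\alpha}(t):=+\infty$ if $t<e_{F\alpha}$, $v_{F\alpha}(t):=-c_\alpha$ if $t=e_{F\alpha}$, $v_{F\alpha}(t):=0$ if $t>e_{F\alpha}$. Configurations: $\mathcal C_n:=\{A\subset\mathcal L_F:\#A=n\}$.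 Energy of $D_n=\{x_1,\dots,x_n\}\in\mathcal C_n$: $V_n(D_n):=\sum_{i\ne j}v_{FF}(|x_i-x_j|)+\sum_{i=1}^n v^1(x_i)$, the first sum being over ordered pairs, with $v^1(x):=\sum_{s\in\partial\mathcal L_S}v_{FS}(|x-s|)$. Connected components of a configuration: those of the graph on $D_n$ joining two atoms exactly when their distance is $1$. Empirical measure: $\mu_{D_n}:=\frac1n\sum_{i=1}^n\delta_{x_i/\sqrt n}$. Classes of models (open segments $(x_F,x_F+q\boldsymbol t_1)$): - $C_1$: $x_F$ has two substrate neighbors. - $C_2$: $x_F$ has exactly one substrate neighbor and $(x_F,x_F+q\boldsymbol t_1)\cap\partial\mathcal L_{FS}=\emptyset$. - $C_3$: $x_F$ has exactly one substrate neighbor and $(x_F,x_F+q\boldsymbol t_1)\cap\partial\mathcal L_{FS}=\{x_F+\frac q2\boldsymbol t_1\}$ (so $q$ is even). - $C_4$: $x_F$ has exactly one substrate neighbor, $q>2$, and there is $s\in\{1,\dots,q-1\}\setminus\{q/2\}$ with $(x_F,x_F+q\boldsymbol t_1)\cap\partial\mathcal L_{FS}=\{x_F+s\boldsymbol t_1\}$. Every model $\mathcal M_\Lambda(x_F,z)$ as in the claim belongs to exactly one of these classes. *)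

(* Defs.v *)
From HB Require Import structures.
From mathcomp Require Import all_boot all_order all_algebra finmap.
From mathcomp Require Import all_classical all_reals all_analysis.
Set Implicit Arguments.
Unset Strict Implicit.
Unset Printing Implicit Defensive.
Import Order.TTheory GRing.Theory Num.Theory.
Import numFieldNormedType.Exports.
Local Open Scope classical_set_scope.
Local Open Scope ring_scope.

Section Defs.
Context {R : realType}.
Implicit Types (p q k s n : nat) (x y xF : R * R) (eFS cF cS : R).
Implicit Types (A B : set (R * R)) (D E : {fset R * R}).

(* The library norm on [R * R] is the sup norm, hence this definition. *)
Definition eucl_dist x y : R := Num.sqrt ((x.1 - y.1) ^+ 2 + (x.2 - y.2) ^+ 2).

Definition dist_pt_set x A : R := inf [set eucl_dist x a | a in A].

Definition dist_set_set A B : R :=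
  inf [set d | exists a b, [/\ A a, B b & d = eucl_dist a b]].

Definition open_segment x y : set (R * R) :=
  [set (1 - t) *: x + t *: y | t in [set t : R | 0 < t < 1]].

Definition lower_half_plane : set (R * R) := [set x | x.2 < 0].

Definition t1 : R * R := (1, 0).
Definition t2 : R * R := (1 / 2, Num.sqrt 3 / 2).

Definition substrate_wall p q : set (R * R) :=
  [set x | exists2 k : int, (q%:Z %| k)%Z & x = (k%:~R / p%:R, 0)].

Definition film xF : set (R * R) :=
  [set x | exists (k1 : int) (k2 : nat),
             x = xF + k1%:~R *: t1 + k2%:R *: t2].

Definition film_boundary xF : set (R * R) :=
  [set x | exists k1 : int, x = xF + k1%:~R *: t1].

Definition film_contact p q eFS xF : set (R * R) :=
  [set x | film_boundary xF x /\ dist_pt_set x (substrate_wall p q) = eFS].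

Definition substrate_neighbors p q eFS x : set (R * R) :=
  [set a | substrate_wall p q a /\ eucl_dist x a = eFS].

(* Sticky-disc potential with contact distance [e] and well depth [c]. *)
Definition sticky (e c t : R) : \bar R :=
  if t < e then +oo%E else if t == e then (- c)%:E else 0%E.

Definition vFF cF (t : R) : \bar R := sticky 1 cF t.
Definition vFS eFS cS (t : R) : \bar R := sticky eFS cS t.

(* [\sum_(a \in A)] is the sum over the support of the summand in [A]; that
   support is finite here, the wall being locally finite. *)
Definition v1 p q eFS cS x : \bar R :=
  (\sum_(a \in substrate_wall p q) vFS eFS cS (eucl_dist x a))%E.

Definition energy p q eFS cF cS D : \bar R :=
  (\sum_(x <- D) \sum_(y <- D | y != x) vFF cF (eucl_dist x y)
   + \sum_(x <- D) v1 p q eFS cS x)%E.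

Definition configurations xF n : set {fset R * R} :=
  [set D | [set` D] `<=` film xF /\ #|` D| = n].

Definition is_minimizer p q xF eFS cF cS n D : Prop :=
  configurations xF n D /\
  forall E, configurations xF n E ->
    (energy p q eFS cF cS D <= energy p q eFS cF cS E)%E.

Definition bonded D : rel D :=
  fun u w : D => eucl_dist (val u) (val w) == 1.

Definition is_component D E : Prop :=
  exists u : D, E = [fset val w | w in connect (@bonded D) u]%fset.

Definition is_largest_component D E : Prop :=
  is_component D E /\
  forall E', is_component D E' -> (#|` E'| <= #|` E|)%N.

Definition rescale n x : R * R := (Num.sqrt n%:R)^-1 *: x.

Definition empirical_measure D (A : set (measurableTypeR R * measurableTypeR R))
    : \bar R :=
  ((#|` D|%:R^-1)%:E *
   \sum_(x <- D) (\d_(rescale #|` D| x : measurableTypeR R * measurableTypeR R) A))%E.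

Definition class1 p q eFS xF : Prop :=
  (substrate_neighbors p q eFS xF #= `I_2)%card.

Definition inner_contacts p q eFS xF : set (R * R) :=
  open_segment xF (xF + q%:R *: t1) `&` film_contact p q eFS xF.

Definition class2 p q eFS xF : Prop :=
  (substrate_neighbors p q eFS xF #= `I_1)%card /\
  inner_contacts p q eFS xF = set0.

Definition class3 p q eFS xF : Prop :=
  (substrate_neighbors p q eFS xF #= `I_1)%card /\
  inner_contacts p q eFS xF = [set xF + (q%:R / 2) *: t1].

(* [s] is the integer occurring in the definition of the fourth class. *)
Definition class4_with p q eFS xF s : Prop :=
  [/\ (substrate_neighbors p q eFS xF #= `I_1)%card,
      (2 < q)%N,
      (1 <= s <= q - 1)%N,
      s%:R != q%:R / 2 :> R &
      inner_contacts p q eFS xF = [set xF + s%:R *: t1]].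

(* The model determines [s], so quantifying over it universally is the same as
   referring to "the" integer [s]. *)
Definition dewetting p q xF eFS cF cS : Prop :=
  let C1 := class1 p q eFS xF in
  let C2 := class2 p q eFS xF in
  let C3 := class3 p q eFS xF in
  let C4 := class4_with p q eFS xF in
  [/\ [\/ (C1 \/ C2) /\ (1 < q)%N,
          C3 /\ (2 < q)%N |
          exists2 s, C4 s & (1 < s < q - 1)%N] -> cS < 6 * cF,
      (exists2 s, C4 s & s = 1%N \/ s = (q - 1)%N) -> cS < 5 * cF &
      ((C1 \/ C2) /\ q = 1%N) \/ (C3 /\ q = 2%N) -> cS < 4 * cF].

End Defs.

(* Main.v *)
Require Import Defs.
From HB Require Import structures.
From mathcomp Require Import all_boot all_order all_algebra finmap.
From mathcomp Require Import all_classical all_reals all_analysis.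
From mathcomp Require Import zify lra.
Import Order.TTheory GRing.Theory Num.Theory.
Import numFieldNormedType.Exports.

(** Why the theorem holds.

    Measure the energy from the bulk value of [-6 cF] per atom. What remains, the
    excess, is [cF] per oriented broken bond minus the contact energy, and it is
    additive over connected components. Minimizers of [n] atoms will be seen to
    have excess [kappa sqrt n (1 + o(1))] with [kappa > 0], while a component of
    [m] atoms costs at least [kappa sqrt m - O(1)]. As the square root is strictly
    concave, splitting off a positive fraction of the mass would be too expensive.

    Lower bound. In each of the three bond directions every line that meets a set
    contributes two broken oriented bonds ([bonds_le]). A connected piece projects
    onto intervals, so it lies in a lattice hexagon whose three widths are the
    numbers of lines that it meets ([inseparable_hull]): replacing a piece by its
    bounding hexagon neither loses atoms nor raises the excess, up to a bounded
    error in the count of periodic contacts. For hexagons the excess is, up to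
    such an error, a linear function [shape_energy] of the widths and the length
    of the base. The constant [kappa] is defined as the infimum of this function
    over the square root of the size ([shape_constant]); no optimal shape is
    computed. The dewetting condition enters through the fact that contacts never
    pay for the bonds broken by a bottom row ([segments_costly]), which makes
    [kappa] positive and gives the coarse bound [excess_ge_sqrt] for small pieces.

    Upper bound. Dilating a nearly optimal hexagon multiplies its energy by [m]
    and its size by about [m ^ 2] ([hexagon_scale]), and trimming a hexagon to
    exactly [n] atoms does not raise its excess ([trimmed_hexagon]). This gives
    minimizers the excess at most [(kappa + o(1)) sqrt n] ([excess_min_le]), and
    [largest_piece_fraction] concludes.

    There is one exception: if [xF] has two substrate neighbors and
    [2 cS >= 4 cF], a bottom row does pay for itself. Then a single row is optimal
    and every minimizer is connected ([wetting_inseparable]).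

    The rest of the proof determines the contact sites. An atom of the film
    boundary touches the wall exactly when its index lies in one of at most two
    residue classes modulo [q] ([contact_structure], [touches_residues]), and the
    four classes of models say how these are placed ([contact_model]). *)

Set Implicit Arguments.
Unset Strict Implicit.
Unset Printing Implicit Defensive.

(** * Counting in finite sets *)

Section FsetFacts.
Local Open Scope fset_scope.
Local Open Scope ring_scope.

Lemma fset_argmax (T : choiceType) (A : {fset T}) (f : T -> int) x0 :
  x0 \in A -> exists2 x, x \in A & forall y, y \in A -> f y <= f x.
Proof.
move=> x0A; pose g (x : A) := f (val x).
have [x _ xmax] := @Order.TotalTheory.arg_maxP _ _ A [` x0A] predT g isT.
exists (val x); first exact: valP.
by move=> y yA; have := xmax [` yA] isT.
Qed.

Lemma card_int_window (A : {fset int}) (a : int) (u : nat) :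
  (forall x, x \in A -> a <= x < a + u%:Z) -> (#|` A| <= u)%N.
Proof.
move=> sub.
have /fsubset_leq_card/leq_trans -> //:
    A `<=` [fset x in [seq a + i%:Z | i <- iota 0 u]].
  apply/fsubsetP => x /sub xa; rewrite inE; apply/mapP.
  by exists (absz (x - a)); rewrite ?mem_iota; lia.
by rewrite card_fseq (leq_trans (size_undup _)) // size_map size_iota.
Qed.

Lemma window_card_int (A : {fset int}) (a : int) (u : nat) :
  (forall x, a <= x < a + u%:Z -> x \in A) -> (u <= #|` A|)%N.
Proof.
move=> sub.
have sub' : [fset x in [seq a + i%:Z | i <- iota 0 u]] `<=` A.
  apply/fsubsetP => x; rewrite inE => /mapP[i]; rewrite mem_iota => iu ->.
  by apply: sub; lia.
apply: leq_trans (fsubset_leq_card sub').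
rewrite card_fseq undup_id ?size_map ?size_iota //.
by rewrite map_inj_uniq ?iota_uniq // => i j; lia.
Qed.

Lemma card_imfset_inj (T T' : choiceType) (f : T -> T') (A : {fset T}) :
  {in A &, injective f} -> #|` f @` A| = #|` A|.
Proof. by move=> inj; rewrite card_in_imfset. Qed.

Lemma card_fsetM (T T' : choiceType) (A : {fset T}) (B : {fset T'}) :
  #|` A `*` B| = (#|` A| * #|` B|)%N.
Proof.
have -> : A `*` B = [fset p in [seq (x, y) | x <- A, y <- B]].
  apply/fsetP => -[x y]; rewrite !inE /=.
  by apply/andP/allpairsP => [[xA yB] | [[a b] [aA bB [-> ->]]]] //; exists (x, y).
rewrite card_fseq undup_id ?size_allpairs // allpairs_uniq // => -[a b] [c d] _ _.
by case=> -> ->.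
Qed.

End FsetFacts.

(** * Bonds of the triangular lattice and lines of atoms *)

Section LatticeBonds.
Local Open Scope fset_scope.
Local Open Scope ring_scope.
Implicit Types (x y d : int * int) (A C E : {fset int * int}).
Implicit Types (pi ell : int * int -> int) (P : pred (int * int)).

Lemma site_argmax A (f : int * int -> int) x0 : x0 \in A ->
  exists2 x : int * int, x \in A & forall y : int * int, y \in A -> f y <= f x.
Proof. exact: fset_argmax. Qed.

(** Sites are the pairs [(i, j)] standing for [i t1 + j t2], so the three bond
    directions are [t1], [t2] and [t2 - t1]; the lines parallel to them are the
    level sets of [j], [i] and [i + j]. *)
Definition dirE : int * int := (1, 0).
Definition dirNE : int * int := (0, 1).
Definition dirNW : int * int := (-1, 1).

Definition adj x y : bool :=
  has (fun d => (y == x + d) || (x == y + d)) [:: dirE; dirNE; dirNW].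

Lemma adjE x y : adj x y =
  [|| (y.1 == x.1 + 1) && (y.2 == x.2), (x.1 == y.1 + 1) && (x.2 == y.2),
      (y.1 == x.1) && (y.2 == x.2 + 1), (x.1 == y.1) && (x.2 == y.2 + 1),
      (y.1 == x.1 - 1) && (y.2 == x.2 + 1)
    | (x.1 == y.1 - 1) && (x.2 == y.2 + 1)].
Proof.
case: x y => [x1 x2] [y1 y2]; rewrite /adj /= /dirE /dirNE /dirNW.
by rewrite !xpair_eqE /= !addr0 orbF -!orbA.
Qed.

Lemma adj_sym x y : adj x y = adj y x.
Proof. by rewrite /adj; apply: eq_has => d; rewrite orbC. Qed.

Definition bonds d C : nat := #|` [fset x in C | x + d \in C]|.

Definition bond_number C : nat := bonds dirE C + bonds dirNE C + bonds dirNW C.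

Lemma bonds_ends d C :
  (bonds d C + #|` [fset x in C | (x + d)%R \notin C]|)%N = #|` C|.
Proof.
rewrite -(cardfsID [fset x in C | x + d \in C] C) /bonds; congr (_ + _)%N.
  by congr #|` _|; apply/fsetP => x; rewrite !inE; case: (x \in C).
congr #|` _|; apply/fsetP => x; rewrite !inE /=.
by case: (x \in C); rewrite ?andbF ?andbT.
Qed.

(** Every line parallel to [d] that meets the set has a last atom, whose bond in
    direction [d] is broken. *)
Lemma bonds_le d pi ell C :
    (forall x, pi (x + d) = pi x) -> (forall x, ell (x + d) = ell x + 1) ->
  (bonds d C + #|` pi @` C| <= #|` C|)%N.
Proof.
move=> pid elld; rewrite -(bonds_ends d C) leq_add2l.
have /fsubset_leq_card/leq_trans -> //:
    pi @` C `<=` pi @` [fset x in C | x + d \notin C]; last first.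
  exact: leq_imfset_card.
apply/fsubsetP => _ /imfsetP[x /= xC ->].
have xL : x \in [fset y in C | pi y == pi x] by rewrite !inE /= xC eqxx.
have [y] := site_argmax ell xL; rewrite !inE /= => /andP[yC /eqP piy] ymax.
rewrite -piy; apply/imfsetP; exists y => //=; rewrite !inE /= yC /=.
apply/negP => ydC; have := ymax (y + d).
by rewrite !inE /= ydC pid piy eqxx elld => /(_ isT); lia.
Qed.

(** Converse of [bonds_le] for sets that are convex along [d]: the last atom of
    each line is then the only one with a broken bond. *)
Lemma bonds_ge d pi ell C (a : int) (u : nat) :
    (forall x y, pi x = pi y -> ell x = ell y -> x = y) ->
    (forall x y, x \in C -> y \in C -> x + d \notin C -> pi x = pi y ->
       ell y <= ell x) ->
    (forall x, x \in C -> a <= pi x < a + u%:Z) ->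
  (#|` C| <= bonds d C + u)%N.
Proof.
move=> inj conv win; rewrite -(bonds_ends d C) leq_add2l.
rewrite -(card_imfset_inj (f := pi)); last first.
  move=> x y; rewrite !inE /= => /andP[xC xd] /andP[yC yd] pixy.
  by apply: inj => //; apply/eqP; rewrite eq_le !conv.
apply: (@card_int_window _ a) => t /imfsetP[x /=]; rewrite !inE /=.
by move=> /andP[xC _] ->; apply: win.
Qed.

(** Connectedness, stated through cuts instead of paths: this is the form in
    which it is used, with thresholds of projections as cuts. *)
Definition inseparable C := forall P,
  (exists2 x, x \in C & P x) -> (exists2 x, x \in C & ~~ P x) ->
  exists x y, [/\ x \in C, y \in C, adj x y, P x & ~~ P y].

(** A projection that changes by at most 1 along bonds maps a connected set onto
    an interval, so the number of values it takes is the length of its range. *)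
Lemma inseparable_window C pi x0 :
    (forall x y, adj x y -> `|pi x - pi y| <= 1) -> inseparable C ->
    x0 \in C ->
  exists y (u : nat), [/\ y \in C,
    forall x, x \in C -> pi y <= pi x < pi y + u%:Z & (u <= #|` pi @` C|)%N].
Proof.
move=> lip insep x0C.
have [y yC ymin] := site_argmax (fun x => - pi x) x0C.
have [z zC zmax] := site_argmax pi x0C.
have yz := ymin z zC.
exists y, (absz (pi z - pi y + 1)); split => //.
  by move=> x xC; have := ymin x xC; have := zmax x xC; lia.
apply: (@window_card_int _ (pi y)) => t tyz.
have [->|tz] := eqVneq t (pi z); first by apply/imfsetP; exists z.
have [||x [x' [xC x'C xx' /= xt tx']]] := insep (fun x => pi x <= t).
- by exists y => //=; lia.
- by exists z => //=; lia.
- by apply/imfsetP; exists x => //=; have := lip x x' xx'; lia.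
Qed.

Lemma card_fset_split E P (Q Q1 Q2 : pred (int * int)) :
    (forall x, x \in E -> Q x = if P x then Q1 x else Q2 x) ->
  #|` [fset x in E | Q x]| =
  (#|` [fset x in [fset x in E | P x] | Q1 x]|
   + #|` [fset x in [fset x in E | ~~ P x] | Q2 x]|)%N.
Proof.
move=> QE; rewrite -(cardfsID [fset x in E | P x]).
congr (_ + _)%N; congr #|` _|; apply/fsetP => x; rewrite !inE /=;
  case xE: (x \in E) => //=; rewrite ?QE //; case: (P x) => //=.
- by rewrite andbT.
- by rewrite andbF.
Qed.

Lemma card_fset_predC E P :
  #|` E| = (#|` [fset x in E | P x]| + #|` [fset x in E | ~~ P x]|)%N.
Proof.
rewrite -(cardfsID [fset x in E | P x]) /=; congr (_ + _)%N;
  congr #|` _|; apply/fsetP => x; rewrite !inE /=; case: (x \in E) => //=.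
by rewrite andbT.
Qed.

Lemma bonds_split d E P : d \in [:: dirE; dirNE; dirNW] ->
    (forall x y, x \in E -> y \in E -> adj x y -> P x = P y) ->
  bonds d E =
    (bonds d [fset x in E | P x] + bonds d [fset x in E | ~~ P x])%N.
Proof.
move=> din PE; apply: card_fset_split => x xE; rewrite !inE /=.
case xdE: (x + d \in E) => /=; last by case: ifP.
have <- : P x = P (x + d); last by case: (P x).
by apply: PE => //; apply/hasP; exists d => //; rewrite eqxx.
Qed.

End LatticeBonds.

(** * Lattice hexagons and contact counts *)

HB.lock Definition window (n : nat) : {fset int} :=
  [fset i in [seq Posz i | i <- iota 0 n]]%fset.

HB.lock Definition hexagon (h u v : nat) (k : int) : {fset int * int} :=
  [fset x in window u `*` window h | (k <= x.1 + x.2 < k + Posz v)%R]%fset.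

Section Hexagons.
Local Open Scope fset_scope.
Local Open Scope ring_scope.
Implicit Types (x y : int * int) (C E : {fset int * int}).

Lemma in_window n (t : int) : (t \in window n) = (0 <= t < n%:Z).
Proof.
rewrite window.unlock inE; apply/mapP/idP => [[i + ->] | tn]; first by rewrite mem_iota; lia.
by exists (absz t); rewrite ?mem_iota; lia.
Qed.

Lemma card_window n : #|` window n| = n.
Proof.
rewrite window.unlock card_fseq undup_id ?size_map ?size_iota //.
by rewrite map_inj_uniq ?iota_uniq // => i j [].
Qed.

Lemma in_hexagon h u v k x : (x \in hexagon h u v k) =
  [&& 0 <= x.1 < u%:Z, 0 <= x.2 < h%:Z & k <= x.1 + x.2 < k + v%:Z].
Proof. by case: x => i j; rewrite hexagon.unlock !inE /= !in_window -!andbA. Qed.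

(** The base of a hexagon is any segment of its row 0, not the whole row: this
    makes the condition linear, hence stable under dilation. *)
Definition base_fits (u v : nat) (k lo : int) (b : nat) : bool :=
  [&& 0 <= lo, lo + b%:Z <= u%:Z, k <= lo & lo + b%:Z <= k + v%:Z].

Lemma card_hexagon_le h u v k : (#|` hexagon h u v k| <= u * h)%N.
Proof.
rewrite hexagon.unlock; apply: leq_trans (fsubset_leq_card (fset_sub _ _)) _.
by rewrite card_fsetM !card_window.
Qed.

Definition contact_count (w : pred int) (a : int) (s : nat) : nat :=
  count (fun i => w (a + i%:Z)) (iota 0 s).

Definition contacts (w : pred int) C : nat :=
  #|` [fset x in C | (x.2 == 0) && w x.1]|.

Lemma contacts_le w C (a : int) (s : nat) :
    (forall x, x \in C -> x.2 = 0 -> a <= x.1 < a + s%:Z) ->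
  (contacts w C <= contact_count w a s)%N.
Proof.
move=> win; rewrite /contact_count -size_filter /contacts.
have in_contacts (t : int) : a <= t < a + s%:Z -> w t ->
    t \in [seq a + i%:Z | i <- [seq i <- iota 0 s | w (a + i%:Z)]].
  move=> ta wt; apply/mapP; exists (absz (t - a)); last by lia.
  have at_ : a + (absz (t - a))%:Z = t by lia.
  by rewrite mem_filter mem_iota at_ wt /=; lia.
rewrite -(card_imfset_inj (f := fst)); last first.
  move=> [x1 x2] [y1 y2]; rewrite !inE /=.
  by move=> /and3P[_ /eqP-> _] /and3P[_ /eqP-> _] ->.
rewrite -(size_map (fun i : nat => a + i%:Z)).
apply: leq_trans (size_undup _); rewrite -card_fseq.
apply/fsubset_leq_card/fsubsetP => _ /imfsetP[x /= + ->].
rewrite !inE => /and3P[xC /eqP x20 wx]; have xa := win x xC x20.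
exact: in_contacts.
Qed.

Lemma contacts_ge w C (a : int) (s : nat) :
    (forall i, (i < s)%N -> (a + i%:Z, 0) \in C) ->
  (contact_count w a s <= contacts w C)%N.
Proof.
move=> sub; rewrite /contact_count -size_filter.
rewrite -(size_map (fun i : nat => (a + i%:Z, 0 : int))).
set cs := map _ _; have /undup_id <- : uniq cs.
  by rewrite map_inj_uniq ?filter_uniq ?iota_uniq // => i j [] /addrI [].
rewrite -card_fseq; apply/fsubset_leq_card/fsubsetP => x.
rewrite !inE => /mapP[i]; rewrite mem_filter mem_iota => /andP[wi /= si] ->.
by rewrite /= sub //= eqxx wi.
Qed.

End Hexagons.

(** * Excess energy *)

Section Excess.
Local Open Scope fset_scope.
Local Open Scope ring_scope.
Context {R : realType}.
Variables (cF beta : R) (w : pred int).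
Implicit Types (x y : int * int) (C E : {fset int * int}).

(** The energy measured from the bulk value of [-6 cF] per atom. *)
Definition excess C : R :=
  cF * (6 * (#|` C|)%:R - 2 * (bond_number C)%:R) - beta * (contacts w C)%:R.

Lemma excess_split E (P : pred (int * int)) :
    (forall x y, x \in E -> y \in E -> adj x y -> P x = P y) ->
  excess E = excess [fset x in E | P x] + excess [fset x in E | ~~ P x].
Proof.
move=> PE; rewrite /excess /bond_number !(bonds_split _ PE) ?inE ?eqxx ?orbT //.
rewrite [contacts w E](card_fset_split (P := P)
  (Q1 := fun x => (x.2 == 0) && w x.1) (Q2 := fun x => (x.2 == 0) && w x.1));
  last by move=> x _; case: ifP.
rewrite (card_fset_predC E P).
by rewrite /contacts !natrD; lra.
Qed.

Lemma excess_lower C : 0 <= cF ->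
  2 * cF * (#|` snd @` C| + #|` fst @` C|
              + #|` (fun x => (x.1 + x.2)%R) @` C|)%N%:R
    - beta * (contacts w C)%:R <= excess C.
Proof.
move=> cF_ge0; rewrite /excess lerD2r.
have := bonds_le (d := dirE) (pi := snd) (ell := fst) C.
have := bonds_le (d := dirNE) (pi := fst) (ell := snd) C.
have := bonds_le (d := dirNW) (pi := fun x => x.1 + x.2) (ell := snd) C.
move=> /(_ ltac:(by move=> [i j] /=; lia) ltac:(by move=> [i j] /=; lia)) b3.
move=> /(_ ltac:(by move=> [i j] /=; lia) ltac:(by move=> [i j] /=; lia)) b2.
move=> /(_ ltac:(by move=> [i j] /=; lia) ltac:(by move=> [i j] /=; lia)) b1.
move: b1 b2 b3; rewrite -!(ler_nat R) /bond_number !natrD => b1 b2 b3.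
by nra.
Qed.

End Excess.

Section Hull.
Local Open Scope fset_scope.
Local Open Scope ring_scope.
Context {R : realType}.
Variables (cF beta : R) (w : pred int).
Hypotheses (cF_ge0 : 0 <= cF) (beta_ge0 : 0 <= beta).
Implicit Types (x y : int * int) (C E : {fset int * int}).

(** The bounding hexagon of a connected piece is at least as populated as the
    piece and has no more broken bonds, since each of its lines is met by the
    piece. Its row 0 contains the whole span of the row-0 atoms of the piece, so
    counting all contacts in that span only lowers the bound: gaps in the piece,
    even in its bottom row, need not be repaired. *)
Lemma inseparable_hull C x0 :
    inseparable C -> x0 \in C -> (forall x, x \in C -> 0 <= x.2) ->
  exists (h u v : nat) (k lo : int) (b : nat) (a : int),
    [/\ (0 < h)%N && (0 < u)%N, base_fits u v k lo b,
        (#|` C| <= #|` hexagon h u v k|)%N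
      & 2 * cF * (h + u + v)%N%:R - beta * (contact_count w a b)%:R
          <= excess cF beta w C].
Proof.
move=> insep x0C pos.
have lip1 x y : adj x y -> `|x.2 - y.2| <= 1 by rewrite adjE; lia.
have lip2 x y : adj x y -> `|x.1 - y.1| <= 1 by rewrite adjE; lia.
have lip3 x y : adj x y -> `|(x.1 + x.2) - (y.1 + y.2)| <= 1 by rewrite adjE; lia.
have [y1 [h [y1C win1 hle]]] := inseparable_window lip1 insep x0C.
have [y2 [u [y2C win2 ule]]] := inseparable_window lip2 insep x0C.
have [y3 [v [y3C win3 vle]]] := inseparable_window lip3 insep x0C.
have lower : 2 * cF * (h + u + v)%N%:R - beta * (contacts w C)%:R
    <= excess cF beta w C.
  apply: le_trans (excess_lower beta w C cF_ge0); rewrite lerD2r.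
  rewrite ler_wpM2l ?mulr_ge0 // ler_nat; move: hle ule vle => /=.
  by move=> *; apply: leq_add => //; apply: leq_add.
have y1w := win1 _ y1C; have y2w := win2 _ y2C.
have hu_gt0 : (0 < h)%N && (0 < u)%N.
  by clear -y1w y2w; apply/andP; split; lia.
pose k := (y3.1 + y3.2) - y2.1 - y1.2.
have sub_hex : (#|` C| <= #|` hexagon h u v k|)%N.
  rewrite -(card_imfset_inj (f := fun x => (x.1 - y2.1, x.2 - y1.2))); last first.
    by move=> [a b] [c d] _ _ [] /= *; congr (_, _); lia.
  apply/fsubset_leq_card/fsubsetP => _ /imfsetP[x /= xC ->].
  rewrite in_hexagon /=; have := win1 _ xC; have := win2 _ xC.
  by have := win3 _ xC; rewrite /= /k; lia.
(* A piece that does not reach row 0 gets an empty base. *)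
have [y1_gt0|y1_le0] := ltP 0 y1.2.
  exists h, u, v, k, (y1.1 - y2.1), 0%N, 0; split => //.
    have := win1 _ y1C; have := win2 _ y1C; have := win3 _ y1C.
    by rewrite /base_fits /k /=; lia.
  have c0 : contacts w C = 0%N.
    have := @contacts_le w C 0 0 _; rewrite leqn0 => /(_ _)/eqP; apply.
    by move=> x xC x20; have := win1 _ xC; rewrite x20; lia.
  by rewrite c0 in lower.
have y10 : y1.2 = 0 by have := pos _ y1C; lia.
have y1R : y1 \in [fset x in C | x.2 == 0] by rewrite !inE /= y1C y10.
have [l + lmin] := site_argmax (fun x => - x.1) y1R.
have [r + rmax] := site_argmax (fun x => x.1) y1R.
move=> rR lR; have lr := rmax l lR; move: rR lR.
rewrite !inE /= => /andP[rC /eqP r0] /andP[lC /eqP l0].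
exists h, u, v, k, (l.1 - y2.1), (absz (r.1 - l.1 + 1)), l.1; split => //.
  have := win2 _ lC; have := win2 _ rC; have := win3 _ lC; have := win3 _ rC.
  have := win1 _ lC; rewrite /base_fits /k r0 l0.
  by clear -y10 lr; lia.
apply: le_trans lower; rewrite lerD2l lerN2 ler_wpM2l // ler_nat.
apply: contacts_le => x xC x20.
have xR : x \in [fset x in C | x.2 == 0] by rewrite !inE /= xC x20.
by have := lmin x xR; have := rmax x xR; clear; lia.
Qed.

End Hull.

(** * Dilating and trimming hexagons *)

Section HexagonScaling.
Local Open Scope fset_scope.
Local Open Scope ring_scope.
Implicit Types (x y : int * int) (C E : {fset int * int}).

(** Replacing each site by an [m] by [m] rhombus multiplies the three widths by
    exactly [m]; only the rhombi sitting on the last line [i + j = k + v - 1],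
    at most [h] of them, can overflow the dilated hexagon. *)
Lemma hexagon_scale (m h u v : nat) (k : int) :
  (m * m * #|` hexagon h u v k| <=
     #|` hexagon (m * h) (m * u) (m * v) (m%:Z * k)| + m * m * h)%N.
Proof.
set H := hexagon h u v k.
pose H' := [fset x in H | x.1 + x.2 != k + v%:Z - 1].
have cardH : (#|` H| <= #|` H'| + h)%N.
  rewrite -(cardfsID [fset x in H | x.1 + x.2 != k + v%:Z - 1] H) leq_add //.
    by apply/fsubset_leq_card/fsubsetP => x; rewrite !inE /= => /andP[].
  rewrite -(card_imfset_inj (f := snd)); last first.
    move=> [a b] [c d]; rewrite !inE !in_hexagon /= => ab cd bd.
    by rewrite bd in ab *; congr (_, _); lia.
  apply: (@card_int_window _ 0) => t /imfsetP[x /= + ->].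
  by rewrite !inE !in_hexagon; lia.
have cardH' : (#|` H'| * (m * m) <=
    #|` hexagon (m * h) (m * u) (m * v) (m%:Z * k)|)%N.
  have -> : (#|` H'| * (m * m))%N = #|` H' `*` (window m `*` window m)|.
    by rewrite !card_fsetM card_window.
  pose f (z : (int * int) * (int * int)) : int * int :=
    (m%:Z * z.1.1 + z.2.1, m%:Z * z.1.2 + z.2.2).
  have digits (p q a b : int) : 0 <= a < m%:Z -> 0 <= b < m%:Z ->
      m%:Z * p + a = m%:Z * q + b -> p = q /\ a = b.
    move=> am bm pq; have pq' : p = q by nia.
    by split=> //; move: pq; rewrite pq'; lia.
  rewrite -(card_imfset_inj (f := f)); last first.
    move=> [[i j] [a b]] [[i' j'] [a' b']]; rewrite !inE /= !in_window.
    move=> /and3P[_ am bm] /and3P[_ am' bm'] [e1 e2].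
    by have [-> ->] := digits _ _ _ _ am am' e1; have [-> ->] := digits _ _ _ _ bm bm' e2.
  apply/fsubset_leq_card/fsubsetP => _ /imfsetP[[[i j] [a b]] /= + ->].
  rewrite !inE /= !in_window in_hexagon /= => /andP[/andP[iH ij] /andP[am bm]].
  by rewrite in_hexagon /=; nia.
by nia.
Qed.

Lemma initial_segment (T : choiceType) (A : {fset T}) (f : T -> int) (n : nat) :
    {in A &, injective f} -> (n <= #|` A|)%N ->
  exists E : {fset T}, [/\ E `<=` A, #|` E| = n &
    forall x y : T, x \in E -> y \in A -> f y < f x -> y \in E].
Proof.
move=> inj nA; rewrite -(subKn nA); move: (#|` A| - n)%N (leq_subr n #|` A|).
elim=> [|i IHi] iA; first by exists A; rewrite subn0; split.
have [E [EA Ei Elow]] := IHi (ltnW iA).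
have [x0 x0E] : exists x0 : T, x0 \in E by apply/fset0Pn; rewrite -cardfs_gt0 Ei; lia.
have [z zE zmax] := fset_argmax f x0E.
exists (E `\ z); split.
- by rewrite (fsubset_trans _ EA) // fsubD1set.
- by have := cardfsD1 z E; rewrite zE Ei; lia.
move=> x y; rewrite !inE => /andP[_ xE] yA fyx; rewrite (Elow x) // andbT.
by apply: contraTneq fyx => ->; rewrite -leNgt zmax.
Qed.

(** Trimming a hexagon to a prescribed number of atoms costs nothing: filling it
    row by row, from left to right, keeps the set convex along the three bond
    directions, so that there are no more broken bonds than in the full hexagon,
    and once [n >= u] the bottom row is complete. *)
Lemma trimmed_hexagon (R : realType) (cF beta : R) (w : pred int)
    (h u v : nat) (k lo : int) (b n : nat) :
    0 <= cF -> 0 <= beta -> (0 < h)%N -> base_fits u v k lo b -> (u <= n)%N ->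
    (n <= #|` hexagon h u v k|)%N ->
  exists E : {fset int * int}, [/\ forall x, x \in E -> 0 <= x.2, #|` E| = n &
    excess cF beta w E <=
      2 * cF * (h + u + v)%N%:R - beta * (contact_count w lo b)%:R].
Proof.
move=> cF_ge0 beta_ge0 h_gt0 fits un nH.
(* The order of filling: rows have fewer than [u + 1] sites. *)
pose key (x : int * int) := x.2 * (u%:Z + 1) + x.1.
have inj : {in hexagon h u v k &, injective key}.
  move=> [a b'] [c d]; rewrite !in_hexagon /key /= => ab cd e.
  have bd : b' = d by nia.
  by move: e; rewrite bd => /addrI ->.
have [E [/fsubsetP EH cardE low]] := initial_segment inj nH.
have conv d x y :
    x \in E -> y \in E -> x + d \notin E -> x + d \in hexagon h u v k ->
    key (x + d) <= key y -> False.
  move=> xE yE /negP xdE xdH; rewrite le_eqVlt => /orP[/eqP|lt]; last first.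
    by apply: xdE; apply: low lt.
  by move=> /(inj _ _ xdH (EH _ yE)) eq; apply: xdE; rewrite eq.
exists E; split => //; first by move=> x /EH; rewrite in_hexagon => /and3P[_ /andP[]].
have b1 : (#|` E| <= bonds dirE E + h)%N.
  apply: (@bonds_ge _ snd fst _ 0) => [[? ?] [? ?] /= -> -> //|x y xE yE xd /=|x].
    move=> pixy; rewrite leNgt; apply/negP => lt; apply: (conv dirE x y) => //.
      by move: (EH _ xE) (EH _ yE); rewrite !in_hexagon /=; lia.
    by rewrite /key /=; nia.
  by move/EH; rewrite in_hexagon; lia.
have b2 : (#|` E| <= bonds dirNE E + u)%N.
  apply: (@bonds_ge _ fst snd _ 0) => [[? ?] [? ?] /= -> -> //|x y xE yE xd /=|x].
    move=> pixy; rewrite leNgt; apply/negP => lt; apply: (conv dirNE x y) => //.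
      by move: (EH _ xE) (EH _ yE); rewrite !in_hexagon /=; lia.
    by rewrite /key /=; nia.
  by move/EH; rewrite in_hexagon; lia.
have b3 : (#|` E| <= bonds dirNW E + v)%N.
  apply: (@bonds_ge _ (fun x => x.1 + x.2) snd _ k)
    => [[? ?] [? ?] /= e1 e2|x y xE yE xd /=|x].
  - by rewrite e2 in e1 *; congr (_, _); lia.
  - move=> pixy; rewrite leNgt; apply/negP => lt; apply: (conv dirNW x y) => //.
      by move: (EH _ xE) (EH _ yE); rewrite !in_hexagon /=; lia.
    by move: (EH _ xE) (EH _ yE); rewrite !in_hexagon /key /=; nia.
  by move/EH; rewrite in_hexagon; lia.
have c_ge : (contact_count w lo b <= contacts w E)%N.
  apply: contacts_ge => i ib; apply: contraT => notE.
  move: fits; rewrite /base_fits => fits.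
  have zH : (lo + i%:Z, 0) \in hexagon h u v k by rewrite in_hexagon /=; lia.
  have row0 x : x \in E -> x.2 = 0 /\ 0 <= x.1 < lo + i%:Z.
    move=> xE; have lt : key x <= key (lo + i%:Z, 0).
      by rewrite leNgt; apply: contra notE => /(low _ _ xE zH).
    have ne : x != (lo + i%:Z, 0) by apply: contraNneq notE => <-.
    move: (EH _ xE) lt ne; rewrite in_hexagon /key; case: x {xE} => a c /=.
    rewrite xpair_eqE => hx lt ne; have c0 : c = 0 by nia.
    by move: hx lt ne; rewrite c0 eqxx andbT; lia.
  have : (#|` E| <= absz (lo + i%:Z)%R)%N.
    rewrite -(card_imfset_inj (f := fst)); last first.
      by move=> [a c] [a' c'] /row0 /= [-> _] /row0 /= [-> _] ->.
    apply: (@card_int_window _ 0) => t /imfsetP[x /= /row0[_ xi] ->]; lia.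
  by rewrite cardE; lia.
apply: (@le_trans _ _ (2 * cF * (h + u + v)%N%:R - beta * (contacts w E)%:R)); last first.
  by rewrite lerD2l lerN2 ler_wpM2l // ler_nat.
rewrite /excess lerD2r /bond_number.
by move: b1 b2 b3; rewrite -!(ler_nat R) !natrD => *; nra.
Qed.

End HexagonScaling.

(** * Counting periodic contacts *)

Section PeriodicCount.
Local Open Scope ring_scope.
Variables (w : pred int) (q : nat).
Hypotheses (q_gt0 : (0 < q)%N) (w_periodic : forall a, w (a + q%:Z) = w a).

Lemma contact_countD (w' : pred int) a s t :
  contact_count w' a (s + t) =
    (contact_count w' a s + contact_count w' (a + s%:Z) t)%N.
Proof.
rewrite /contact_count iotaD count_cat add0n -[in iota s t](addn0 s) iotaDl.
by rewrite count_map; congr (_ + _)%N; apply: eq_count => i /=; rewrite PoszD addrA.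
Qed.

Lemma contact_count_period a : contact_count w a q = contact_count w 0 q.
Proof.
have one b : contact_count w b 1 = w b by rewrite /contact_count /= addr0 addn0.
have step b : contact_count w (b + 1) q = contact_count w b q.
  have : (contact_count w b q + contact_count w (b + q%:Z) 1 =
          contact_count w b 1 + contact_count w (b + 1) q)%N.
    by rewrite -!contact_countD addnC.
  by rewrite !one w_periodic; lia.
elim/int_rec: a => [//|n IH|n IH]; first by rewrite intS addrC step.
by rewrite -IH -[in RHS](subrK 1 (- n%:Z)) step intS opprD addrC.
Qed.

Lemma contact_countM a t :
  contact_count w a (t * q) = (t * contact_count w 0 q)%N.
Proof.
elim: t a => [a|t IH a]; first by [].
by rewrite !mulSn contact_countD contact_count_period IH.
Qed.

Lemma contact_count_bounds a s :
  ((s %/ q) * contact_count w 0 q <= contact_count w a s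
    <= (s %/ q).+1 * contact_count w 0 q)%N.
Proof.
have := divn_eq s q; move: (s %/ q)%N => t sE.
have r_lt := ltn_pmod s q_gt0; apply/andP; split.
  by rewrite sE contact_countD contact_countM leq_addr.
rewrite -(contact_countM a).
have -> : (t.+1 * q = s + (t.+1 * q - s))%N by lia.
by rewrite contact_countD leq_addr.
Qed.

Lemma contact_count_density (R : realType) (a : int) (s : nat) :
  `|(contact_count w a s)%:R - (contact_count w 0 q)%:R / q%:R * s%:R|
    <= (contact_count w 0 q)%:R :> R.
Proof.
set c := (contact_count w 0 q)%:R : R.
have q0 : (0 : R) < q%:R by rewrite ltr0n.
have sE : s%:R = (s %/ q)%:R * q%:R + (s %% q)%:R :> R.
  by rewrite -natrM -natrD -divn_eq.
have r_le : (s %% q)%:R <= q%:R :> R by rewrite ler_nat ltnW ?ltn_pmod.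
have r_ge : (0 : R) <= (s %% q)%:R by [].
have c_ge : 0 <= c by rewrite ler0n.
have -> : c / q%:R * s%:R = (s %/ q)%:R * c + c * ((s %% q)%:R / q%:R).
  have qV : q%:R / q%:R = 1 :> R by rewrite mulfV ?lt0r_neq0.
  rewrite sE (_ : c / q%:R * _ = (s %/ q)%:R * c * (q%:R / q%:R)
                               + c * ((s %% q)%:R / q%:R)); last by lra.
  by rewrite qV mulr1.
have f_ge : 0 <= (s %% q)%:R / q%:R :> R by rewrite divr_ge0 // ltW.
have f_le : (s %% q)%:R / q%:R <= 1 :> R by rewrite ler_pdivrMr // mul1r.
have := contact_count_bounds a s; rewrite -!(ler_nat R) !natrM -addn1 natrD -/c.
by move=> /andP[lo hi]; rewrite ler_distl; apply/andP; split; nra.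
Qed.

End PeriodicCount.

(** * The isoperimetric constant *)

Section HexagonSize.
Local Open Scope ring_scope.

Definition hexagon_size h u v k : nat := #|` hexagon h u v k|%fset.

Lemma sqrt_hexagon_size_le (R : realType) (h u v : nat) (k : int) :
  Num.sqrt (hexagon_size h u v k)%:R <= (h + u + v)%N%:R :> R.
Proof.
rewrite -[leRHS]ger0_norm // -sqrtr_sqr ler_wsqrtr // -natrX ler_nat.
apply: leq_trans (card_hexagon_le _ _ _ _) _.
by rewrite -mulnn; nia.
Qed.

End HexagonSize.

Section ShapeConstant.
Local Open Scope classical_set_scope.
Local Open Scope ring_scope.
Context {R : realType}.
Variables (cF theta c : R).
Hypotheses (cF_gt0 : 0 < cF) (theta_ge0 : 0 <= theta) (c_gt0 : 0 < c).
Hypothesis theta_lt : theta + c <= 4 * cF.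

(** The excess of a hexagon with base of length [b] when contacts are replaced by
    their mean density; [theta] is the mean contact energy per site. Being
    linear in the widths, it is multiplied by [m] under dilation by [m]. *)
Definition shape_energy (h u v b : nat) : R :=
  2 * cF * (h + u + v)%N%:R - theta * b%:R.

Lemma shape_energy_ge (h u v : nat) (k lo : int) (b : nat) : base_fits u v k lo b ->
  c / 4 * (h + u + v)%N%:R <= shape_energy h u v b.
Proof.
move: theta_lt theta_ge0 cF_gt0 c_gt0 => tc t0 cF0 c0.
move=> /and4P[lo0 bu klo bv]; rewrite /shape_energy.
have {}bu : (b <= u)%N by lia.
have {}bv : (b <= v)%N by lia.
have h0 : 0 <= h%:R :> R by [].
move: bu bv; rewrite -!(ler_nat R) !natrD => bu bv.
have b0 : 0 <= b%:R :> R by [].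
have uv0 : 0 <= u%:R + v%:R :> R by rewrite addr_ge0.
have tb : theta * (2 * b%:R) <= theta * (u%:R + v%:R) by rewrite ler_wpM2l //; lra.
have tuv : theta * (u%:R + v%:R) <= (4 * cF - c) * (u%:R + v%:R).
  by rewrite ler_wpM2r //; lra.
have ch : c * h%:R <= 4 * cF * h%:R by rewrite ler_wpM2r //; lra.
have cFh : 0 <= cF * h%:R by rewrite mulr_ge0 // ltW.
have cuv : 0 <= c * (u%:R + v%:R) by rewrite mulr_ge0 // ltW.
by lra.
Qed.

(** The constant [kappa] is the best ratio of energy to the square root of the
    size. The size is diminished by [h] because dilation by [m] provably
    multiplies only this diminished size by [m ^ 2]: a nearly optimal hexagon
    then stays nearly optimal when dilated. *)
Lemma shape_constant : exists2 kappa : R, 0 < kappa &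
  (forall (h u v : nat) (k lo : int) (b : nat), (0 < h)%N -> base_fits u v k lo b ->
     (h < hexagon_size h u v k)%N ->
     kappa * Num.sqrt (hexagon_size h u v k - h)%N%:R <= shape_energy h u v b) /\
  (forall eta, 0 < eta -> exists (h u v : nat) (k lo : int) (b : nat),
     [/\ (0 < h)%N, base_fits u v k lo b, (h < hexagon_size h u v k)%N &
      shape_energy h u v b
        <= (kappa + eta) * Num.sqrt (hexagon_size h u v k - h)%N%:R]).
Proof.
pose S : set R := [set r | exists (h u v : nat) (k lo : int) (b : nat),
   [/\ (0 < h)%N, base_fits u v k lo b, (h < hexagon_size h u v k)%N &
   r = shape_energy h u v b / Num.sqrt (hexagon_size h u v k - h)%N%:R]].
have sqrt_gt0 (h n : nat) : (h < n)%N -> 0 < Num.sqrt (n - h)%N%:R :> R.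
  by move=> hn; rewrite sqrtr_gt0 ltr0n subn_gt0.
have S_lb : lbound S (c / 4).
  move=> _ [h [u [v [k [lo [b [h0 fits hN ->]]]]]]].
  rewrite ler_pdivlMr ?sqrt_gt0 //.
  apply: (le_trans _ (shape_energy_ge h fits)); rewrite ler_wpM2l ?divr_ge0 ?(ltW c_gt0) //.
  apply: (le_trans _ (sqrt_hexagon_size_le _ h u v k)).
  by rewrite ler_wsqrtr // ler_nat leq_subr.
have S_ne : S !=set0.
  pose r := shape_energy 1 2 2 0 / Num.sqrt (hexagon_size 1 2 2 0 - 1)%N%:R.
  exists r; exists 1%N, 2%N, 2%N, 0, 0, 0%N; split => //.
  have -> : hexagon_size 1 2 2 0 = #|` [fset (0, 0); (1, 0)] : {fset int * int}|%fset.
    congr #|` _|%fset; apply/fsetP => -[i j]; rewrite in_hexagon !inE /=.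
    by rewrite !xpair_eqE; lia.
  by rewrite cardfs2.
have S_inf : has_inf S by split => //; exists (c / 4).
exists (inf S).
  by apply: (@lt_le_trans _ _ (c / 4)); [rewrite divr_gt0 | exact: lb_le_inf].
split=> [h u v k lo b h0 fits hN | eta eta0].
  rewrite -ler_pdivlMr ?sqrt_gt0 //; apply: ge_inf; first by exists (c / 4).
  by exists h, u, v, k, lo, b.
have [_ [h [u [v [k [lo [b [h0 fits hN ->]]]]]]]] := inf_adherent eta0 S_inf.
rewrite ltr_pdivrMr ?sqrt_gt0 // => /ltW le.
by exists h, u, v, k, lo, b.
Qed.

End ShapeConstant.

(** * Two-sided estimate of the excess *)

Section Scaling.
Local Open Scope ring_scope.

Lemma base_fits_scale m u v k lo b : base_fits u v k lo b ->
  base_fits (m * u) (m * v) (m%:Z * k) (m%:Z * lo) (m * b).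
Proof.
move=> /and4P[lo0 bu klo bv]; apply/and4P; rewrite !PoszM -!mulrDr.
by split; rewrite ?mulr_ge0 // ler_wpM2l.
Qed.

Lemma hexagon_scale_size m h u v k :
  (m * m * (hexagon_size h u v k - h) <=
     hexagon_size (m * h) (m * u) (m * v) (m%:Z * k))%N.
Proof. by rewrite mulnBr leq_subLR addnC; apply: hexagon_scale. Qed.

Lemma least_scale (A n u : nat) : (0 < A)%N -> ((u + 1) * (u + 1) <= n)%N ->
  exists m, [/\ (0 < m)%N, (n <= m * m * A)%N, (m * u <= n)%N &
                (m.-1 * m.-1 * A <= n)%N].
Proof.
move=> A0 un.
have n_gt0 : (0 < n)%N by apply: leq_trans un; rewrite addn1 muln_gt0.
have ex_m : exists m : nat, (n <= m * m * A)%N.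
  by exists n; rewrite -mulnA leq_pmulr // muln_gt0 n_gt0.
case: (ex_minnP ex_m) => m nm m_min.
have m0 : (0 < m)%N by case: posnP nm => // ->; rewrite !mul0n leqNgt n_gt0.
have m1n : (m.-1 * m.-1 * A < n)%N.
  by rewrite ltnNge; apply/negP => /m_min; rewrite leqNgt prednK // leqnn.
exists m; split => //; last exact: ltnW.
have m1 : (m.-1 * m.-1 < n)%N by apply: leq_ltn_trans m1n; rewrite leq_pmulr.
rewrite -(prednK m0) in m1 *; move: m.-1 m1 => t /=; clear -un => tn.
by have [tu|ut] := leqP t u; nia.
Qed.

End Scaling.

Section ExcessBounds.
Local Open Scope ring_scope.
Context {R : realType}.
Variables (cF beta rho K c : R) (w : pred int).
Hypotheses (cF_gt0 : 0 < cF) (beta_ge0 : 0 <= beta) (rho_ge0 : 0 <= rho).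
Hypotheses (c_gt0 : 0 < c) (slack : beta * rho + c <= 4 * cF).
Hypothesis density : forall (a : int) (s : nat),
  `|(contact_count w a s)%:R - rho * s%:R| <= K.
Hypothesis segment_cost : forall (a : int) (s : nat), (0 < s)%N ->
  c * s%:R <= cF * (4 * s%:R + 2) - beta * (contact_count w a s)%:R.
Implicit Types (C E : {fset int * int}).

(** Coarse bound without additive error, which is what controls small pieces.
    The hull has at most [(h + u + v) ^ 2] sites, and [segment_cost] leaves a
    positive amount of broken bonds per unit of width. *)
Lemma excess_ge_sqrt C x0 : inseparable C -> x0 \in C ->
    (forall x, x \in C -> 0 <= x.2) ->
  c / 4 * Num.sqrt (#|` C|%fset)%:R <= excess cF beta w C.
Proof.
move=> insep x0C pos.
have [h [u [v [k [lo [b [a [/andP[h0 u0] fits CN low]]]]]]]] :=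
  inseparable_hull w (ltW cF_gt0) beta_ge0 insep x0C pos.
apply: le_trans low.
apply: (@le_trans _ _ (c / 4 * (h + u + v)%N%:R)).
  rewrite ler_wpM2l ?divr_ge0 ?(ltW c_gt0) //.
  apply: (@le_trans _ _ (Num.sqrt (hexagon_size h u v k)%:R)).
    by rewrite ler_wsqrtr // ler_nat.
  exact: sqrt_hexagon_size_le.
have c_le : c <= 4 * cF by apply: le_trans slack; rewrite lerDr mulr_ge0.
move/and4P: fits => [lo0 bu klo bv].
have {}bu : (b <= u)%N by lia.
have {}bv : (b <= v)%N by lia.
move: c_gt0 cF_gt0 => c0 cF0.
have [b0|b0] := posnP b.
  rewrite b0 /contact_count /= mulr0 subr0.
  by rewrite ler_wpM2r //; lra.
have := segment_cost a b0; move: h0 u0 bu bv.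
rewrite -!(ler_nat R) !natrD => h0 u0 bu bv seg.
have e1 : 0 <= (4 * cF - c) * (h%:R - 1) by rewrite mulr_ge0; lra.
have e2 : 0 <= (4 * cF - c) * (u%:R - b%:R) by rewrite mulr_ge0; lra.
have e3 : 0 <= (4 * cF - c) * (v%:R - b%:R) by rewrite mulr_ge0; lra.
have e4 : 0 <= c * (h%:R - 1) by rewrite mulr_ge0; lra.
have e5 : 0 <= c * (u%:R - 1) by rewrite mulr_ge0; lra.
have e6 : 0 <= c * v%:R by rewrite mulr_ge0 //; lra.
by lra.
Qed.

Variable kappa : R.
Hypothesis kappa_gt0 : 0 < kappa.
Hypothesis kappa_le : forall (h u v : nat) (k lo : int) (b : nat),
  (0 < h)%N -> base_fits u v k lo b -> (h < hexagon_size h u v k)%N ->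
  kappa * Num.sqrt (hexagon_size h u v k - h)%N%:R
    <= shape_energy cF (beta * rho) h u v b.
Hypothesis kappa_approx : forall eta : R, 0 < eta ->
  exists (h u v : nat) (k lo : int) (b : nat),
     [/\ (0 < h)%N, base_fits u v k lo b, (h < hexagon_size h u v k)%N &
      shape_energy cF (beta * rho) h u v b
        <= (kappa + eta) * Num.sqrt (hexagon_size h u v k - h)%N%:R].

(** Passing from the diminished size back to the size costs a constant only: a
    hexagon whose height exceeds a multiple of the square root of its size has
    large energy because of its height alone. *)
Lemma shape_energy_ge_sqrt (h u v : nat) (k lo : int) (b : nat) :
    (0 < h)%N -> base_fits u v k lo b ->
  kappa * Num.sqrt (hexagon_size h u v k)%:R - kappa ^+ 2 / (c / 4)
    <= shape_energy cF (beta * rho) h u v b.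
Proof.
move=> h0 fits; set N := hexagon_size h u v k; set x := Num.sqrt N%:R.
set P := shape_energy _ _ _ _ _ _; set d := c / 4.
have d0 : 0 < d by rewrite divr_gt0.
have dP : d * h%:R <= P.
  apply: (le_trans _ (shape_energy_ge cF_gt0 (mulr_ge0 beta_ge0 rho_ge0) c_gt0 slack h fits)).
  by rewrite ler_wpM2l ?(ltW d0) // ler_nat -addnA leq_addr.
have x0 : 0 <= x by rewrite sqrtr_ge0.
have xx : x ^+ 2 = N%:R by rewrite sqr_sqrtr.
have h_ge0 : 0 <= h%:R :> R by [].
have P0 : 0 <= P by apply: le_trans dP; rewrite mulr_ge0 // ltW.
move: kappa_gt0 => k0.
set t := kappa / d; have t0 : 0 < t by rewrite divr_gt0.
have kE : kappa = t * d by rewrite /t divfK // gt_eqF.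
have -> : kappa ^+ 2 / d = kappa * t by rewrite expr2 -mulrA.
have [kxP|Px] := leP (kappa * x) P.
  by apply: le_trans kxP; rewrite lerBlDr lerDl mulr_ge0 // ltW.
have hx : h%:R <= t * x.
  rewrite -(ler_pM2l d0); apply: ltW (le_lt_trans dP _).
  by rewrite mulrA [d * t]mulrC -kE.
have [hN|Nh] := ltnP h N.
  apply: (le_trans _ (kappa_le h0 fits hN)); rewrite -/N -mulrBr ler_pM2l //.
  have [xt|tx] := leP x t; first by rewrite (@le_trans _ _ 0) ?sqrtr_ge0 ?subr_le0.
  rewrite -[leLHS]ger0_norm ?subr_ge0 ?(ltW tx) // -sqrtr_sqr ler_wsqrtr //.
  have tt : t * t <= t * x by rewrite ler_wpM2l // ltW.
  by rewrite natrB ?(ltnW hN) // -xx; lra.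
have xt : x <= t.
  have [->|xn0] := eqVneq x 0; first exact: ltW.
  have xp : 0 < x by rewrite lt_neqAle eq_sym xn0.
  by rewrite -(ler_pM2r xp) (le_trans _ hx) // -expr2 xx ler_nat.
by apply: (le_trans _ P0); rewrite -mulrBr mulr_ge0_le0 ?subr_le0 // ltW.
Qed.

Lemma excess_ge_kappa_sqrt C x0 : inseparable C -> x0 \in C ->
    (forall x, x \in C -> 0 <= x.2) ->
  kappa * Num.sqrt (#|` C|%fset)%:R - (kappa ^+ 2 / (c / 4) + beta * K)
    <= excess cF beta w C.
Proof.
move=> insep x0C pos.
have [h [u [v [k [lo [b [a [/andP[h0 u0] fits CN low]]]]]]]] :=
  inseparable_hull w (ltW cF_gt0) beta_ge0 insep x0C pos.
apply: le_trans low.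
have P_ge := shape_energy_ge_sqrt h0 fits.
have s_le : kappa * Num.sqrt (#|` C|%fset)%:R
    <= kappa * Num.sqrt (hexagon_size h u v k)%:R.
  by rewrite ler_pM2l // ler_wsqrtr // ler_nat.
have := density a b; rewrite ler_distl => /andP[_ dens].
have := ler_wpM2l beta_ge0 dens; move: P_ge; rewrite /shape_energy => *.
by lra.
Qed.

(** Dilate a nearly optimal hexagon by the least [m] that makes it large enough
    and trim it. *)
Lemma excess_min_le (eta : R) : 0 < eta -> exists n0 : nat, forall n, (n0 <= n)%N ->
  exists E, [/\ forall x, x \in E -> 0 <= x.2, #|` E|%fset = n &
    excess cF beta w E <= (kappa + eta) * Num.sqrt n%:R].
Proof.
move=> eta0.
have eta2 : 0 < eta / 2 by rewrite divr_gt0.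
have [h [u [v [k [lo [b [h0 fits hN P_le]]]]]]] := kappa_approx eta2.
move: P_le; set P := shape_energy _ _ _ _ _ _.
set A := (hexagon_size h u v k - h)%N; have A0 : (0 < A)%N by rewrite subn_gt0.
move=> P_le.
pose X := (P + beta * K) / (eta / 2).
exists (maxn ((u + 1) * (u + 1)) (Num.bound (X ^+ 2)))%N => n.
rewrite geq_max => /andP[un Xn].
have X_le : X <= Num.sqrt n%:R.
  apply: le_trans (ler_norm _) _; rewrite -sqrtr_sqr ler_wsqrtr //.
  apply: ltW (lt_le_trans (archi_boundP (sqr_ge0 X)) _).
  by rewrite ler_nat.
have [m [m0 nm mun m1n]] := least_scale A0 un.
have fits' := base_fits_scale m fits.
have nH : (n <= #|` hexagon (m * h) (m * u) (m * v) (m%:Z * k)|%fset)%N.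
  exact: (leq_trans nm (hexagon_scale_size _ _ _ _ _)).
have mh0 : (0 < m * h)%N by rewrite muln_gt0 m0.
have [E [pos cardE E_le]] :=
  trimmed_hexagon w (ltW cF_gt0) beta_ge0 mh0 fits' mun nH.
exists E; split => //; apply: le_trans E_le _.
have := density (m%:Z * lo) (m * b); rewrite ler_distl => /andP[dens _].
have := ler_wpM2l beta_ge0 dens => {}dens.
apply: (@le_trans _ _ (m%:R * P + beta * K)).
  by move: dens; rewrite /P /shape_energy -!mulnDr !natrM; lra.
have mE : m%:R = m.-1%:R + 1 :> R by rewrite -{1}(prednK m0) -natr1.
have m1A : m.-1%:R * Num.sqrt A%:R <= Num.sqrt n%:R :> R.
  rewrite -[m.-1%:R]ger0_norm // -sqrtr_sqr -sqrtrM ?sqr_ge0 // ler_wsqrtr //.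
  by rewrite -natrX -natrM ler_nat -mulnn.
have m1P : m.-1%:R * P <= (kappa + eta / 2) * Num.sqrt n%:R.
  apply: (@le_trans _ _ ((kappa + eta / 2) * (m.-1%:R * Num.sqrt A%:R))).
    by rewrite mulrCA ler_wpM2l.
  by rewrite ler_wpM2l // addr_ge0 // ltW.
have PX : P + beta * K <= eta / 2 * Num.sqrt n%:R.
  by rewrite [leRHS]mulrC -ler_pdivrMr.
by rewrite mE mulrDl mul1r; lra.
Qed.

End ExcessBounds.

(** * One piece carries almost all atoms *)

Section LargestPiece.
Local Open Scope ring_scope.
Context {R : realType}.
Variables (cF beta : R) (w : pred int).
Implicit Types (C E : {fset int * int}).

Definition bond_closed C E : Prop :=
  forall x y, x \in C -> y \in E -> adj x y -> y \in C.

Lemma separable_split E : ~ inseparable E -> exists P : pred (int * int),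
  [/\ forall x y, x \in E -> y \in E -> adj x y -> P x = P y,
      exists2 x, x \in E & P x & exists2 x, x \in E & ~~ P x].
Proof.
move=> /existsNP[P /not_implyP[exP /not_implyP[exN /forallNP noX]]].
exists P; split => // x y xE yE xy.
have imp z t : z \in E -> t \in E -> adj z t -> P z -> P t.
  move=> zE tE zt Pz; apply: contra_notT (noX z) => Nt.
  by exists t; split.
by apply/idP/idP; apply: imp => //; rewrite adj_sym.
Qed.

(** A linear lower bound on the excess passes from connected components to the
    whole set, as the excess is additive over components. *)
Lemma excess_ge_sum (gamma : R) E :
    (forall C x, bond_closed C E -> inseparable C -> (C `<=` E)%fset -> x \in C ->
       gamma * #|` C|%fset%:R <= excess cF beta w C) ->
  gamma * #|` E|%fset%:R <= excess cF beta w E.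
Proof.
move=> pieces.
suff sum n C : (#|` C|%fset < n)%N -> bond_closed C E -> (C `<=` E)%fset ->
    gamma * #|` C|%fset%:R <= excess cF beta w C.
  by apply: (sum #|` E|.+1%fset) => // x y.
elim: n C => [//|n IH] C Cn closed sub.
have [->|[x0 x0C]] := fset_0Vmem C.
  rewrite /excess /bond_number /bonds /contacts.
  have f0 (P : pred (int * int)) : [fset x in fset0 | P x]%fset = fset0.
    by apply/fsetP => x; rewrite !inE.
  by rewrite !f0 !cardfs0 !mulr0 !subr0 mulr0.
have [insep|/separable_split[P [adjP [x xC Px] [y yC Py]]]] := pselect (inseparable C).
  exact: pieces closed insep sub x0C.
rewrite (excess_split _ _ _ adjP).
have cardC := card_fset_predC C P.
rewrite cardC natrD mulrDr; apply: lerD; apply: IH.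
- have : (0 < #|` [fset x in C | ~~ P x]|%fset)%N.
    by rewrite cardfs_gt0; apply/fset0Pn; exists y; rewrite !inE yC.
  by move: Cn; rewrite cardC; lia.
- move=> z t; rewrite !inE /= => /andP[zC Pz] tE zt.
  have tC := closed _ _ zC tE zt.
  by rewrite tC -(adjP _ _ zC tC zt).
- by apply/fsubsetP => z; rewrite !inE => /andP[zC _]; apply: (fsubsetP sub).
- have : (0 < #|` [fset x in C | P x]|%fset)%N.
    by rewrite cardfs_gt0; apply/fset0Pn; exists x; rewrite !inE xC.
  by move: Cn; rewrite cardC; lia.
- move=> z t; rewrite !inE /= => /andP[zC Pz] tE zt.
  have tC := closed _ _ zC tE zt.
  by rewrite tC -(adjP _ _ zC tC zt).
- by apply/fsubsetP => z; rewrite !inE => /andP[zC _]; apply: (fsubsetP sub).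
Qed.

Variables (rho K c : R).
Hypotheses (cF_gt0 : 0 < cF) (beta_ge0 : 0 <= beta) (rho_ge0 : 0 <= rho).
Hypotheses (c_gt0 : 0 < c) (slack : beta * rho + c <= 4 * cF).
Hypothesis density : forall (a : int) (s : nat),
  `|(contact_count w a s)%:R - rho * s%:R| <= K.
Hypothesis segment_cost : forall (a : int) (s : nat), (0 < s)%N ->
  c * s%:R <= cF * (4 * s%:R + 2) - beta * (contact_count w a s)%:R.

(** If no component has more than [M] atoms, a component of [m] atoms satisfies
    [sqrt m >= m / sqrt M], so the bounds in [sqrt m] yield the linear bound
    [(1 - d) kappa m / sqrt M], hence a total of at least
    [(1 - d) kappa n / sqrt M]. Comparison with the upper bound
    [(1 + d) kappa sqrt n] for minimizers leaves only [M] close to [n]. *)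
Lemma largest_piece_fraction (eps : R) : 0 < eps ->
  exists n0 : nat, forall n E M, (n0 <= n)%N -> #|` E|%fset = n ->
    (forall x, x \in E -> 0 <= x.2) ->
    (forall E', #|` E'|%fset = n -> (forall x, x \in E' -> 0 <= x.2) ->
       excess cF beta w E <= excess cF beta w E') ->
    (forall C x, bond_closed C E -> inseparable C -> (C `<=` E)%fset -> x \in C ->
       (#|` C|%fset <= M)%N) ->
  (1 - eps) * n%:R <= M%:R.
Proof.
move=> eps0.
have [kappa k0 [k_le k_approx]] :=
  shape_constant cF_gt0 (mulr_ge0 beta_ge0 rho_ge0) c_gt0 slack.
have K0 : 0 <= K by apply: le_trans (density 0 0); rewrite normr_ge0.
pose d := Num.min (eps / 4) (1 / 2).
have d0 : 0 < d by rewrite lt_min !divr_gt0.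
have d1 : d <= 1 / 2 by rewrite ge_min lexx orbT.
have d_eps : d <= eps / 4 by rewrite ge_min lexx.
have [a aE] : exists a, a = c / 4 by exists (c / 4).
have a0 : 0 < a by rewrite aE divr_gt0.
pose K1 := kappa ^+ 2 / a + beta * K.
have K1_ge0 : 0 <= K1 by rewrite addr_ge0 ?divr_ge0 ?mulr_ge0 ?sqr_ge0 // ltW.
have dk0 : 0 < d * kappa by rewrite mulr_gt0.
(* Pieces with at least [tau ^ 2] atoms absorb the additive error [K1] of the
   sharp bound; smaller ones use the coarse bound, which beats the required
   one as soon as [M] is large. *)
pose tau := K1 / (d * kappa); have tau0 : 0 <= tau by rewrite divr_ge0 // ltW.
have tauE : tau * (d * kappa) = K1 by rewrite /tau divfK // gt_eqF.
have [n1 upper] := excess_min_le cF_gt0 beta_ge0 density k0 k_approx dk0.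
pose Y := 2 * kappa * (kappa * tau) / (a * a).
exists (maxn 1 (maxn n1 (Num.bound (Y ^+ 2)))) => n E M.
rewrite !geq_max => /and3P[n_gt0 n1n Yn] cardE pos minE pieces.
pose r : R := Num.sqrt n%:R.
have r0 : 0 < r by rewrite sqrtr_gt0 ltr0n.
have rr : r * r = n%:R by rewrite -expr2 sqr_sqrtr.
have Yr : Y <= r.
  apply: le_trans (ler_norm _) _; rewrite -sqrtr_sqr ler_wsqrtr //.
  by apply: ltW (lt_le_trans (archi_boundP (sqr_ge0 Y)) _); rewrite ler_nat.
have [E' [pos' cardE' E'_le]] := upper n n1n.
have E_le : excess cF beta w E <= (kappa + d * kappa) * r.
  exact: le_trans (minE _ cardE' pos') E'_le.
(* With [M = 0] there would be no component at all, and every linear lower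
   bound would hold. *)
have M_gt0 : (0 < M)%N.
  rewrite lt0n; apply/negP => /eqP M0.
  pose g : R := `|excess cF beta w E| + 1.
  have : g * n%:R <= excess cF beta w E.
    rewrite -cardE; apply: excess_ge_sum => C x closed insep sub xC.
    have := pieces C x closed insep sub xC; rewrite M0 leqn0 cardfs_eq0 => /eqP C0.
    by rewrite C0 in xC.
  have g_le : g <= g * n%:R by rewrite ler_peMr ?addr_ge0 // ler1n.
  by have := ler_norm (excess cF beta w E); rewrite /g in g_le *; lra.
pose S : R := Num.sqrt M%:R.
have S0 : 0 < S by rewrite sqrtr_gt0 ltr0n.
have SS : S * S = M%:R by rewrite -expr2 sqr_sqrtr.
have piece_sqrt C x : bond_closed C E -> inseparable C -> (C `<=` E)%fset ->
    x \in C -> exists s : R, [/\ 0 <= s, s <= S, #|` C|%fset%:R = s * s,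
      a * s <= excess cF beta w C & kappa * s - K1 <= excess cF beta w C].
  move=> closed insep sub xC; exists (Num.sqrt #|` C|%fset%:R).
  have posC y : y \in C -> 0 <= y.2 by move=> /(fsubsetP sub)/pos.
  split; first exact: sqrtr_ge0.
  - by rewrite ler_wsqrtr // ler_nat (pieces C x).
  - by rewrite -expr2 sqr_sqrtr.
  - rewrite aE; exact: (excess_ge_sqrt cF_gt0 beta_ge0 rho_ge0 c_gt0
              slack segment_cost insep xC).
  - rewrite /K1 aE; exact: (excess_ge_kappa_sqrt cF_gt0 beta_ge0 rho_ge0 c_gt0
              slack density k0 k_le insep xC).
have weak : a / S * n%:R <= excess cF beta w E.
  rewrite -cardE; apply: excess_ge_sum => C x closed insep sub xC.
  have [s [s0 sS -> le _]] := piece_sqrt C x closed insep sub xC.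
  apply: le_trans le; rewrite mulrAC ler_pdivrMr // -mulrA ler_pM2l //.
  by rewrite ler_wpM2l.
have aS : kappa * tau <= a * S.
  have h1 : a * n%:R <= (kappa + d * kappa) * r * S.
    by rewrite -ler_pdivrMr // mulrAC; apply: le_trans weak _.
  have h2 : a * r <= 2 * kappa * S.
    have arr : a * r * r = a * n%:R by rewrite -rr mulrA.
    rewrite -(ler_pM2r r0) arr; apply: le_trans h1 _.
    rewrite [leRHS]mulrAC ler_pM2r // ler_pM2r //.
    have : d * kappa <= 1 / 2 * kappa by rewrite ler_pM2r.
    by lra.
  have h3 : a * Y <= a * r by rewrite ler_pM2l.
  have YE : Y * (a * a) = 2 * kappa * (kappa * tau).
    by rewrite /Y divfK // mulf_neq0 // gt_eqF.
  have k20 : 0 < 2 * kappa by rewrite mulr_gt0.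
  have h4 : a * (a * Y) <= a * (2 * kappa * S).
    by rewrite ler_pM2l //; apply: le_trans h3 h2.
  by rewrite -(ler_pM2l k20) -YE; lra.
have strong : (1 - d) * kappa / S * n%:R <= excess cF beta w E.
  rewrite -cardE; apply: excess_ge_sum => C x closed insep sub xC.
  have [s [s0 sS -> le1 le2]] := piece_sqrt C x closed insep sub xC.
  have k1 : 0 <= (1 - d) * kappa by rewrite mulr_ge0 ?subr_ge0 ?(ltW k0) //; lra.
  rewrite mulrAC ler_pdivrMr //.
  have [taus|staus] := leP tau s.
    apply: (@le_trans _ _ ((1 - d) * kappa * s * S)).
      by rewrite mulrA ler_wpM2l // mulr_ge0.
    rewrite ler_pM2r //; apply: le_trans le2.
    have : tau * (d * kappa) <= s * (d * kappa) by rewrite ler_pM2r.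
    by rewrite tauE; lra.
  apply: (@le_trans _ _ (a * s * S)); last by rewrite ler_pM2r.
  have ks : kappa * s <= a * S.
    by apply: le_trans aS; rewrite ler_pM2l // ltW.
  have dks : 0 <= d * kappa * s by rewrite mulr_ge0 // ltW.
  rewrite mulrA [leRHS]mulrAC ler_wpM2r //.
  by lra.
have ratio : (1 - d) * r <= (1 + d) * S.
  have : (1 - d) * kappa * n%:R <= (kappa + d * kappa) * r * S.
    by rewrite -ler_pdivrMr // mulrAC; apply: le_trans strong _.
  rewrite -rr => h; rewrite -(ler_pM2l k0) -(ler_pM2r r0).
  by lra.
have sq : ((1 - d) * r) ^+ 2 <= ((1 + d) * S) ^+ 2.
  rewrite ler_sqr ?nnegrE //; rewrite mulr_ge0 // ?ltW //; lra.
rewrite !exprMn [r ^+ 2]expr2 [S ^+ 2]expr2 rr SS in sq.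
have n0 : 0 <= n%:R :> R by [].
have Mle : 0 <= M%:R :> R by [].
have q0 : 0 < (1 + d) ^+ 2 by rewrite exprn_gt0 // addr_gt0.
rewrite -(ler_pM2l q0); apply: le_trans sq; rewrite mulrA ler_wpM2r //.
have [e1|e1] := leP 1 eps.
  apply: (@le_trans _ _ 0); last exact: sqr_ge0.
  by rewrite mulr_ge0_le0 ?sqr_ge0 // subr_le0.
by nra.
Qed.

End LargestPiece.

(** * Which contact patterns are covered *)

Section ContactPatterns.
Local Open Scope ring_scope.
Context {R : realType}.
Variables (cF beta : R) (w : pred int).
Implicit Types (C E : {fset int * int}).

(** A row of [s] atoms breaks [4 s + 2] bonds; the contacts it gains must not pay
    for them, uniformly in [s]. This is how the dewetting condition is used. *)
Definition segments_costly : Prop := exists2 c : R, 0 < c &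
  forall (a : int) (s : nat), (0 < s)%N ->
    c * s%:R <= cF * (4 * s%:R + 2) - beta * (contact_count w a s)%:R.

Lemma contact_count2 (a : int) : contact_count w a 2 = (w a + w (a + 1)%R)%N.
Proof. by rewrite /contact_count /= addr0 addn0. Qed.

Lemma contact_count3 (a : int) :
  contact_count w a 3 = (w a + w (a + 1)%R + w (a + 2)%R)%N.
Proof. by rewrite /contact_count /= addr0 addn0 addnA. Qed.

Lemma contact_count_le (a : int) (s : nat) : (contact_count w a s <= s)%N.
Proof. by rewrite -[leqRHS](size_iota 0 s) count_size. Qed.

Lemma dense_segments_costly : 0 < cF -> 0 <= beta -> beta < 4 * cF -> segments_costly.
Proof.
move=> cF0 b0 lt; exists (4 * cF - beta); first by lra.
move=> a s _; have := contact_count_le a s; rewrite -(ler_nat R) => le.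
by have := ler_wpM2l b0 le; lra.
Qed.

(** The critical segments are single contact atoms, with 6 broken bonds. *)
Lemma isolated_segments_costly : 0 < cF -> 0 <= beta -> beta < 6 * cF ->
  (forall a, w a -> w (a + 1) -> False) -> segments_costly.
Proof.
move=> cF0 b0 lt isol; exists ((6 * cF - beta) / 2); first by lra.
have count (n : nat) : forall a s, (s < n)%N -> (2 * contact_count w a s <= s + 1)%N.
  elim: n => [//|n IH] a [|[|s]] sn; first by rewrite /contact_count.
    by have := contact_count_le a 1; lia.
  have sE : s.+2 = (2 + s)%N by lia.
  rewrite sE contact_countD contact_count2.
  have := IH (a + 2%:Z) s ltac:(lia); have := isol a.
  by case: (w a) (w (a + 1)) => [] [] => [/(_ isT isT)|_|_|_]; lia.
move=> a s s0; have := count s.+1 a s (ltnSn s); rewrite -(ler_nat R) natrM natrD => le.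
have := ler_wpM2l b0 le; move: s0; rewrite -(ler_nat R) => s1.
have e1 : 0 <= (6 * cF - beta) * (s%:R - 1) by rewrite mulr_ge0; lra.
have e2 : 0 <= cF * (s%:R - 1) by rewrite mulr_ge0; lra.
by lra.
Qed.

(** The critical segments are pairs of contact atoms, with 10 broken bonds. *)
Lemma paired_segments_costly : 0 < cF -> 0 <= beta -> beta < 5 * cF ->
  (forall a, w a -> w (a + 1) -> w (a + 2) -> False) -> segments_costly.
Proof.
move=> cF0 b0 lt pair; exists ((5 * cF - beta) / 3); first by lra.
have count (n : nat) : forall a s, (s < n)%N -> (3 * contact_count w a s <= 2 * s + 2)%N.
  elim: n => [//|n IH] a [|[|[|s]]] sn; first by rewrite /contact_count.
  - by have := contact_count_le a 1; lia.
  - by have := contact_count_le a 2; lia.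
  have sE : s.+3 = (3 + s)%N by lia.
  rewrite sE contact_countD contact_count3.
  have := IH (a + 3%:Z) s ltac:(lia); have := pair a.
  by case: (w a) (w (a + 1)) (w (a + 2)) => [] [] []
    => [/(_ isT isT isT)|_|_|_|_|_|_|_]; lia.
move=> a s s0; have := count s.+1 a s (ltnSn s).
rewrite -(ler_nat R) natrD !natrM => le.
have le' := ler_wpM2l b0 le.
have [->|s2] : s = 1%N \/ (2 <= s)%N by lia.
  have := contact_count_le a 1; rewrite -(ler_nat R) => le1.
  by have := ler_wpM2l b0 le1; lra.
move: s2; rewrite -(ler_nat R) => s2.
have e1 : 0 <= (5 * cF - beta) * (s%:R - 2) by rewrite mulr_ge0; lra.
have e2 : 0 <= cF * (s%:R - 2) by rewrite mulr_ge0; lra.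
by lra.
Qed.

(** Applied to arbitrarily many periods, [segments_costly] bounds the mean contact
    energy per site by [4 cF - c]. *)
Lemma periodic_largest_piece (q : nat) (eps : R) :
    0 < cF -> 0 <= beta -> (0 < q)%N -> (forall a, w (a + q%:Z) = w a) ->
    segments_costly -> 0 < eps ->
  exists n0 : nat, forall n E M, (n0 <= n)%N -> #|` E|%fset = n ->
    (forall x, x \in E -> 0 <= x.2) ->
    (forall E', #|` E'|%fset = n -> (forall x, x \in E' -> 0 <= x.2) ->
       excess cF beta w E <= excess cF beta w E') ->
    (forall C x, bond_closed C E -> inseparable C -> (C `<=` E)%fset -> x \in C ->
       (#|` C|%fset <= M)%N) ->
  (1 - eps) * n%:R <= M%:R.
Proof.
move=> cF0 b0 q0 per [c c0 cost] eps0.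
pose t : R := (contact_count w 0 q)%:R; have t0 : 0 <= t by [].
have q0' : 0 < q%:R :> R by rewrite ltr0n.
apply: (@largest_piece_fraction _ cF beta w (t / q%:R) t c) => //.
- by rewrite divr_ge0 // ltW.
- rewrite -(ler_pM2r q0') mulrDl -!mulrA mulVf ?gt_eqF // mulr1 leNgt.
  apply/negP => lt; pose g := (beta * t + c * q%:R) - 4 * (cF * q%:R).
  have g0 : 0 < g by rewrite /g; lra.
  have g1 : 0 <= 2 * cF / g by rewrite divr_ge0 ?mulr_ge0 // ltW.
  have := archi_boundP g1.
  set N := Num.bound _ => lt2.
  have N0 : (0 < N.+1 * q)%N by rewrite muln_gt0.
  have := cost 0 _ N0; rewrite contact_countM // !natrM -/t -natr1.
  have : 2 * cF < N%:R * g by rewrite -ltr_pdivrMr.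
  by rewrite /g; lra.
- exact: contact_count_density.
Qed.

(** When every boundary site is a contact of energy at least [4 cF], a single row
    is optimal. For an arbitrary nonempty set, [excess_lower] and the fact that
    row-0 atoms lie on distinct lines in two directions give an excess of at
    least [2 cF + (4 cF - beta) n]; a row of [n] atoms attains this value, and a
    disconnected set would pay the constant [2 cF] at least twice. *)
Lemma wetting_inseparable n E : 0 < cF -> 4 * cF <= beta -> (forall a, w a) ->
    #|` E|%fset = n -> (forall x, x \in E -> 0 <= x.2) ->
    (forall E', #|` E'|%fset = n -> (forall x, x \in E' -> 0 <= x.2) ->
       excess cF beta w E <= excess cF beta w E') ->
  inseparable E.
Proof.
move=> cF0 b4 wT cardE pos minE; apply: contrapT.
move=> /separable_split[P [adjP [x xE Px] [y yE Py]]].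
have lower C z : z \in C -> 2 * cF + (4 * cF - beta) * #|` C|%fset%:R
    <= excess cF beta w C.
  move=> zC; apply: le_trans (excess_lower beta w C (ltW cF0)).
  have c1 : (contacts w C <= #|` [fset x.1 | x in C]|)%fset%N.
    rewrite /contacts -(card_imfset_inj (f := fst)); last first.
      move=> [a b] [c d]; rewrite !inE /= => /and3P[_ /eqP-> _] /and3P[_ /eqP-> _].
      by move=> ->.
    apply/fsubset_leq_card/fsubsetP => _ /imfsetP[s /= + ->].
    by rewrite !inE => /andP[sC _]; apply/imfsetP; exists s.
  have c2 : (contacts w C <= #|` [fset (x.1 + x.2)%R | x in C]|)%fset%N.
    rewrite /contacts -(card_imfset_inj (f := fun x => x.1 + x.2)); last first.
      move=> [a b] [c d]; rewrite !inE /= => /and3P[_ /eqP-> _] /and3P[_ /eqP-> _].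
      by rewrite !addr0 => ->.
    apply/fsubset_leq_card/fsubsetP => _ /imfsetP[s /= + ->].
    by rewrite !inE => /andP[sC _]; apply/imfsetP; exists s.
  have c3 : (contacts w C <= #|` C|)%fset%N by apply/fsubset_leq_card/fset_sub.
  have c4 : (1 <= #|` [fset x.2 | x in C]|)%fset%N.
    by rewrite cardfs_gt0; apply/fset0Pn; exists z.2; apply/imfsetP; exists z.
  move: c1 c2 c3 c4; rewrite -!(ler_nat R) !natrD => c1 c2 c3 c4.
  have := ler_wpM2l (ltW cF0) c1; have := ler_wpM2l (ltW cF0) c2.
  have := ler_wpM2l (ltW cF0) c4.
  have b40 : 0 <= beta - 4 * cF by lra.
  have := ler_wpM2l b40 c3.
  by lra.
have n0 : (0 < n)%N by rewrite -cardE cardfs_gt0; apply/fset0Pn; exists x.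
have fits : base_fits n n 0 0 n by rewrite /base_fits !add0r !lexx.
have nH : (n <= #|` hexagon 1 n n 0|)%fset%N.
  rewrite -{1}(card_window n) -(card_imfset_inj (f := fun i : int => (i, 0 : int))).
    apply/fsubset_leq_card/fsubsetP => _ /imfsetP[i /= + ->].
    by rewrite in_window in_hexagon /=; lia.
  by move=> i j _ _ [].
have b0 : 0 <= beta by lra.
have [E' [pos' cardE' E'_le]] :=
  trimmed_hexagon w (ltW cF0) b0 (isT : (0 < 1)%N) fits (leqnn n) nH.
have cc : contact_count w 0 n = n.
  rewrite /contact_count (eq_count (a2 := predT)) ?count_predT ?size_iota //.
  by move=> i; rewrite wT.
rewrite cc in E'_le.
have := minE _ cardE' pos'; rewrite (excess_split cF beta w adjP).
have xP : x \in [fset x in E | P x]%fset by rewrite !inE xE.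
have yP : y \in [fset x in E | ~~ P x]%fset by rewrite !inE yE.
have := lower _ _ xP; have := lower _ _ yP.
move: cardE E'_le; rewrite (card_fset_predC E P) => <-; rewrite !natrD.
by lra.
Qed.

End ContactPatterns.

(** * The film lattice in the plane *)

Section LatticeEmbedding.
Local Open Scope ring_scope.
Context {R : realType}.
Variable xF : R * R.
Implicit Types (x y : int * int) (C E : {fset int * int}).

Definition film_site x : R * R := xF + x.1%:~R *: t1 + x.2%:~R *: t2.

Lemma film_siteE x : film_site x =
  (xF.1 + x.1%:~R + x.2%:~R / 2, xF.2 + x.2%:~R * (Num.sqrt 3 / 2)).
Proof.
rewrite /film_site /t1 /t2; congr (_, _) => /=.
by rewrite /GRing.scale /= mulr1 mul1r.
by rewrite /GRing.scale /= mulr0 addr0.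
Qed.

Lemma film_site_dist_sqr x y (u := x.1 - y.1) (v := x.2 - y.2) :
  ((film_site x).1 - (film_site y).1) ^+ 2 + ((film_site x).2 - (film_site y).2) ^+ 2
    = (u ^+ 2 + u * v + v ^+ 2)%:~R.
Proof.
rewrite !film_siteE /= /u /v !(rmorphD, rmorphB, rmorphXn, rmorphM) /=.
have s3 : Num.sqrt 3 ^+ 2 = 3 :> R by rewrite sqr_sqrtr.
set s := Num.sqrt 3 in s3 *.
have e : (xF.2 + x.2%:~R * (s / 2) - (xF.2 + y.2%:~R * (s / 2))) ^+ 2
    = s ^+ 2 * ((x.2%:~R - y.2%:~R) ^+ 2 / 4) by lra.
by rewrite e s3; lra.
Qed.

Lemma eucl_dist_film x y (u := x.1 - y.1) (v := x.2 - y.2) :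
  eucl_dist (film_site x) (film_site y) = Num.sqrt (u ^+ 2 + u * v + v ^+ 2)%:~R.
Proof. by rewrite /eucl_dist film_site_dist_sqr. Qed.

Lemma hex_norm_ge1 (u v : int) : (u, v) != (0, 0) -> 1 <= u ^+ 2 + u * v + v ^+ 2.
Proof.
rewrite xpair_eqE => uv.
have sq : 0 <= (2 * u + v) * (2 * u + v) by rewrite -expr2 sqr_ge0.
rewrite !expr2; have [v0|v0] := eqVneq v 0.
  have u0 : 0 < u * u by nia.
  by rewrite v0; lia.
have v2 : 0 < v * v by nia.
by nia.
Qed.

Lemma hex_norm_ge0 (u v : int) : 0 <= u ^+ 2 + u * v + v ^+ 2.
Proof.
have [[-> ->]//|/hex_norm_ge1 h] := eqVneq (u, v) (0, 0).
exact: le_trans h.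
Qed.

Lemma hex_norm_eq1 (u v : int) : (u ^+ 2 + u * v + v ^+ 2 == 1) =
  [|| (u == 1) && (v == 0), (u == -1) && (v == 0), (u == 0) && (v == 1),
      (u == 0) && (v == -1), (u == 1) && (v == -1) | (u == -1) && (v == 1)].
Proof.
rewrite !expr2; apply/eqP/idP => [h|]; last first.
  by move=> /or4P[|||/or3P[||]] /andP[/eqP-> /eqP->].
have vb : -1 <= v <= 1 by nia.
have ub : -1 <= u <= 1 by nia.
have [v1|[v1|v1]] : v = -1 \/ v = 0 \/ v = 1 by lia.
all: have [u1|[u1|u1]] : u = -1 \/ u = 0 \/ u = 1 by lia.
all: by rewrite v1 u1 // in h *.
Qed.

Lemma adj_hex_norm x y (u := x.1 - y.1) (v := x.2 - y.2) :
  adj x y = (u ^+ 2 + u * v + v ^+ 2 == 1).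
Proof. by rewrite adjE hex_norm_eq1 /u /v; lia. Qed.

Lemma film_site_bonded x y :
  (eucl_dist (film_site x) (film_site y) == 1) = adj x y.
Proof.
rewrite eucl_dist_film adj_hex_norm; set N := _ + _ + _.
have N0 : 0 <= N by exact: hex_norm_ge0.
rewrite -(eqr_int R) -[RHS]eqr_sqrt //; first by rewrite sqrtr1.
by rewrite ler0z.
Qed.

Lemma film_site_dist_ge1 x y : x != y ->
  1 <= eucl_dist (film_site x) (film_site y).
Proof.
move=> xy; rewrite eucl_dist_film -[leLHS]sqrtr1 ler_wsqrtr // -[1]/(1%:~R) ler_int.
apply: hex_norm_ge1; apply: contraNneq xy => -[/eqP + /eqP].
by rewrite !subr_eq0 => /eqP e1 /eqP e2; apply/eqP; case: x y e1 e2 => [? ?] [? ?] /= -> ->.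
Qed.

Lemma film_site_inj : injective film_site.
Proof.
move=> x y e; apply/eqP; apply: contraT => /film_site_dist_ge1.
by rewrite e /eucl_dist !subrr expr0n addr0 sqrtr0 ler10.
Qed.

Lemma filmP (a : R * R) :
  film xF a <-> exists2 x, 0 <= x.2 & a = film_site x.
Proof.
split=> [[k1 [k2 ->]]|[[k1 [k2|//]] _ ->]].
  by exists (k1, k2%:Z).
by exists k1, k2.
Qed.

End LatticeEmbedding.

(** * From plane configurations to lattice sites *)

Section EnergyTransport.
Local Open Scope ring_scope.
Context {R : realType}.
Implicit Types (x y d : int * int) (C E : {fset int * int}).

Lemma card_fset_count (T : choiceType) (A : {fset T}) (P : pred T) :
  #|` [fset x in A | P x]|%fset = (\sum_(x <- A) P x)%N.
Proof.
rewrite card_fset_sum1 big_imfset //= big_filter big_mkcond /=.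
by apply: eq_bigr => x _; case: (P x).
Qed.

Lemma sum_eq_mem E (a : int * int) : (\sum_(y <- E) (y == a) = (a \in E))%N.
Proof.
rewrite -(count_uniq_mem _ (fset_uniq E)) -sum1_count [RHS]big_mkcond /=.
by apply: eq_bigr => y _; case: (y == a).
Qed.

Lemma adj_nat x y : (adj x y : nat) =
  ((y == x + dirE)%R + (x == y + dirE)%R + ((y == x + dirNE)%R + (x == y + dirNE)%R)
   + ((y == x + dirNW)%R + (x == y + dirNW)%R))%N.
Proof.
rewrite adjE; case: x y => [x1 x2] [y1 y2]; rewrite !xpair_eqE /= !addr0.
have back (a b : int) :
    [/\ (b == a + 1) = (a == b - 1), (b == a - 1) = (a == b + 1)
      & (b == a) = (a == b)] by split; lia.
have [-> -> ->] := back y1 x1; have [-> _ ->] := back y2 x2.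
have excl (a b : int) : [/\ ~~ ((b == a) && (b == a + 1)),
    ~~ ((b == a) && (b == a - 1)) & ~~ ((b == a + 1) && (b == a - 1))].
  by split; lia.
have := excl x1 y1; have := excl x2 y2.
case: (y1 == x1); case: (y1 == x1 + 1); case: (y1 == x1 - 1) => //=;
  case: (y2 == x2); case: (y2 == x2 + 1); case: (y2 == x2 - 1) => //=.
all: by move=> [? ? ?] [? ? ?].
Qed.

Lemma sum_adj E : (\sum_(x <- E) \sum_(y <- E) adj x y = 2 * bond_number E)%N.
Proof.
have one d : (\sum_(x <- E) \sum_(y <- E) (y == x + d)%R = bonds d E)%N.
  by rewrite /bonds card_fset_count; apply: eq_bigr => x _; apply: sum_eq_mem.
have two d : (\sum_(x <- E) \sum_(y <- E) (x == y + d)%R = bonds d E)%N.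
  by rewrite exchange_big.
under eq_bigr do (under eq_bigr do rewrite adj_nat).
under eq_bigr do rewrite !big_split.
by rewrite !big_split /= !one !two /bond_number; lia.
Qed.

Variables (xF : R * R) (p q : nat) (eFS cF cS beta : R) (w : pred int).
Hypothesis substrate_energy : forall x, 0 <= x.2 ->
  v1 p q eFS cS (film_site xF x) = (- (beta * ((x.2 == 0) && w x.1)%:R))%:E.

Lemma energyE E : (forall x, x \in E -> 0 <= x.2) ->
  energy p q eFS cF cS (film_site xF @` E)%fset
    = (excess cF beta w E - 6 * cF * #|` E|%fset%:R)%:E.
Proof.
move=> pos; rewrite /energy.
have inj : {in E &, injective (film_site xF)} by move=> x y _ _ /film_site_inj.
rewrite !big_imfset //=.
have -> : (\sum_(x <- E) v1 p q eFS cS (film_site xF x) =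
    (- (beta * (contacts w E)%:R))%:E)%E.
  rewrite big_seq (eq_bigr (fun x => (- (beta * ((x.2 == 0) && w x.1)%:R))%:E)); last first.
    by move=> x xE; rewrite substrate_energy ?pos.
  rewrite -big_seq sumEFin; congr (_%:E).
  by rewrite sumrN -mulr_sumr -natr_sum /contacts card_fset_count.
have -> : (\sum_(x <- E) \sum_(y <- (film_site xF @` E)%fset | y != film_site xF x)
     vFF cF (eucl_dist (film_site xF x) y) = (- (cF * (2 * bond_number E)%N%:R))%:E)%E.
  have inner x : (\sum_(y <- (film_site xF @` E)%fset | y != film_site xF x)
      vFF cF (eucl_dist (film_site xF x) y) =
      (- (cF * (\sum_(y <- E) adj x y)%N%:R))%:E)%E.
    rewrite big_mkcond big_imfset //= natr_sum mulr_sumr -sumrN -sumEFin.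
    apply: eq_bigr => y _; rewrite (inj_eq (@film_site_inj _ _)).
    have [->|yx] := eqVneq y x.
      have -> : adj x x = false by rewrite adjE; lia.
      by rewrite /= mulr0 oppr0.
    have ge1 : 1 <= eucl_dist (film_site xF x) (film_site xF y).
      by apply: film_site_dist_ge1; rewrite eq_sym.
    rewrite /vFF /sticky film_site_bonded ltNge ge1.
    by case: (adj x y); rewrite ?mulr1 ?mulr0 ?oppr0.
  rewrite (eq_bigr _ (fun x _ => inner x)) sumEFin sumrN -mulr_sumr -natr_sum.
  by rewrite sum_adj.
by rewrite -EFinD; congr (_%:E); rewrite /excess natrM; lra.
Qed.

Lemma configurationsP n (D : {fset R * R}) : configurations xF n D <->
  exists E, [/\ D = (film_site xF @` E)%fset, forall x, x \in E -> 0 <= x.2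
              & #|` E|%fset = n].
Proof.
have card E : #|` film_site xF @` E|%fset = #|` E|%fset.
  by apply: card_imfset_inj => x y _ _ /film_site_inj.
split=> [[Dfilm Dn]|[E [-> pos En]]]; last first.
  split; last by rewrite card.
  move=> a /= /imfsetP[x /= xE ->]; apply/filmP.
  by exists x => //; exact: pos.
pose coord a := xget (0, 0) [set x | 0 <= x.2 /\ a = film_site xF x].
have coordP a : a \in D -> 0 <= (coord a).2 /\ a = film_site xF (coord a).
  move=> aD; have /filmP[x x0 ax] := Dfilm a aD.
  by rewrite /coord; case: xgetP => [y -> //|/(_ x)]; case.
exists (coord @` D)%fset; split.
- apply/fsetP => a; apply/idP/imfsetP => /= [aD|[_ /imfsetP[b /= bD ->] ->]].
    by exists (coord a); [apply/imfsetP; exists a | have [] := coordP a aD].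
  by have [_ <-] := coordP b bD.
- by move=> _ /imfsetP[a /= aD ->]; have [] := coordP a aD.
rewrite card_imfset_inj // => a b aD bD ab.
by have [_ ->] := coordP a aD; have [_ ->] := coordP b bD; rewrite ab.
Qed.

Lemma minimizer_film n (D : {fset R * R}) : is_minimizer p q xF eFS cF cS n D ->
  exists E, [/\ D = (film_site xF @` E)%fset, #|` E|%fset = n,
    forall x, x \in E -> 0 <= x.2 &
    forall E', #|` E'|%fset = n -> (forall x, x \in E' -> 0 <= x.2) ->
       excess cF beta w E <= excess cF beta w E'].
Proof.
move=> [/configurationsP[E [-> pos En]] minE]; exists E; split => // E' E'n pos'.
have := minE (film_site xF @` E')%fset.
rewrite !energyE // lee_fin En E'n lerD2r; apply.
by apply/configurationsP; exists E'.
Qed.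

(** Sites of [C] reachable from [x] by paths cannot be separated from the others
    by a cut, so they exhaust [C]; closedness keeps paths inside [C]. *)
Lemma piece_component E C x :
    bond_closed C E -> inseparable C -> (C `<=` E)%fset -> x \in C ->
  is_component (film_site xF @` E)%fset (film_site xF @` C)%fset.
Proof.
move=> closed insep sub xC; set D := (film_site xF @` E)%fset.
have inD y : y \in E -> film_site xF y \in D by move=> yE; apply/imfsetP; exists y.
have CE y : y \in C -> y \in E by exact: (fsubsetP sub).
pose u : D := [` inD x (CE x xC)]%fset.
exists u; apply/fsetP => a; apply/imfsetP/imfsetP => [[y /= yC ->]|[z /= uz ->]].
  suff : y \in C -> forall yE : y \in E, connect (@bonded _ D) u [` inD y yE]%fset.
    by move=> /(_ yC)/(_ (CE y yC)) con; exists [` inD y (CE y yC)]%fset.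
  move=> {}yC yE; apply: contraT => ncon.
  pose P (z : int * int) : bool :=
    `[< forall zE : z \in E, connect (@bonded _ D) u [` inD z zE]%fset >].
  have [||z [t [zC tC zt /asboolP Pz /asboolP nPt]]] := insep P.
  - exists x => //; apply/asboolP => zE.
    by rewrite (_ : [` _]%fset = u) ?connect0 //; apply: val_inj.
  - by exists y => //; apply/asboolP => /(_ yE); apply/negP.
  exfalso; apply: nPt => tE; apply: connect_trans (Pz (CE z zC)) _.
  by apply: connect1; rewrite /bonded /= film_site_bonded.
have : val z \in (film_site xF @` C)%fset.
  case/connectP: uz => s su ->; elim/last_ind: s su => [_|s v IH].
    by apply/imfsetP; exists x.
  rewrite rcons_path last_rcons => /andP[/IH/imfsetP[y /= yC ye] /eqP].
  have /imfsetP[t /= tE te] := valP v; rewrite ye te => /eqP.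
  rewrite film_site_bonded => yt; apply/imfsetP; exists t => //=.
  exact: closed yC tE yt.
by move=> /imfsetP[y /= yC ->]; exists y.
Qed.

End EnergyTransport.

(** * Mass concentration along a sequence of minimizers *)

Section MassConcentration.
Local Open Scope classical_set_scope.
Local Open Scope ring_scope.
Context {R : realType}.
Variables (xF : R * R) (p q : nat) (eFS cF cS beta : R) (w : pred int).
Hypothesis substrate_energy : forall x : int * int, 0 <= x.2 ->
  v1 p q eFS cS (film_site xF x) = (- (beta * ((x.2 == 0) && w x.1)%:R))%:E.
Hypotheses (cF_gt0 : 0 < cF) (beta_ge0 : 0 <= beta).
Hypotheses (q_gt0 : (0 < q)%N) (w_periodic : forall a, w (a + q%:Z) = w a).
Hypothesis dichotomy :
  segments_costly cF beta w \/ (4 * cF <= beta /\ forall a, w a).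
Variables D D1 : nat -> {fset R * R}.
Hypothesis D_min : forall n, (0 < n)%N -> is_minimizer p q xF eFS cF cS n (D n).
Hypothesis D1_comp : forall n, (0 < n)%N -> is_largest_component (D n) (D1 n).

Lemma component_sub (A B : {fset R * R}) : is_component A B -> (B `<=` A)%fset.
Proof.
by move=> [u ->]; apply/fsubsetP => _ /imfsetP[v /= _ ->]; apply: valP.
Qed.

Lemma card_minimizer n : (0 < n)%N -> #|` D n|%fset = n.
Proof. by move=> /D_min[[]]. Qed.

Lemma card_component_le n : (0 < n)%N -> (#|` D1 n| <= n)%fset%N.
Proof.
move=> n0; rewrite -[leqRHS](card_minimizer n0).
by have [/component_sub/fsubset_leq_card] := D1_comp n0.
Qed.

Lemma component_fraction (eps : R) : 0 < eps -> exists n0 : nat, forall n,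
  (n0 <= n)%N -> (0 < n)%N -> (1 - eps) * n%:R <= #|` D1 n|%fset%:R.
Proof.
move=> eps0.
have piece_le n E C x : (0 < n)%N -> D n = (film_site xF @` E)%fset ->
    bond_closed C E -> inseparable C -> (C `<=` E)%fset -> x \in C ->
    (#|` C| <= #|` D1 n|)%fset%N.
  move=> n0 DE closed insep sub xC.
  have [_ /(_ (film_site xF @` C)%fset)] := D1_comp n0.
  rewrite card_imfset_inj => [|y z _ _ /film_site_inj //]; apply.
  by rewrite DE; apply: piece_component closed insep sub xC.
case: dichotomy => [costly|[wet wT]].
  have [n0 conc] := periodic_largest_piece cF_gt0 beta_ge0 q_gt0 w_periodic costly eps0.
  exists n0 => n n0n n_gt0.
  have [E [DE En pos minE]] := minimizer_film substrate_energy (D_min n_gt0).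
  apply: (conc n E) => // C x closed insep sub xC.
  exact: piece_le closed insep sub xC.
exists 0%N => n _ n_gt0.
have [E [DE En pos minE]] := minimizer_film substrate_energy (D_min n_gt0).
have insep := wetting_inseparable cF_gt0 wet wT En pos minE.
have [x xE] : exists x, x \in E by apply/fset0Pn; rewrite -cardfs_gt0 En.
have : (n <= #|` D1 n|)%fset%N.
  by rewrite -{1}En; apply: piece_le xE => //.
rewrite -(ler_nat R); apply: le_trans.
by rewrite ler_piMl // lerBlDr lerDl ltW.
Qed.

Lemma cvg_component_fraction :
  (fun n => #|` D1 n|%fset%:R / n%:R : R) @ \oo --> (1 : R).
Proof.
apply/cvgrPdist_le => eps eps0.
have [n0 conc] := component_fraction eps0.
near=> n.
have n_gt0 : (0 < n)%N by near: n; exists 1%N.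
have n0n : (n0 <= n)%N by near: n; exists n0.
have n_pos : 0 < n%:R :> R by rewrite ltr0n.
have le1 : #|` D1 n|%fset%:R / n%:R <= 1 :> R.
  by rewrite ler_pdivrMr // mul1r ler_nat card_component_le.
rewrite ger0_norm ?subr_ge0 // lerBlDr -lerBlDl ler_pdivlMr //.
exact: conc.
Unshelve. all: by end_near.
Qed.

Lemma empirical_measure_component n : (0 < n)%N ->
  empirical_measure (D n) [set rescale n x | x in [set` D1 n]]
    = (#|` D1 n|%fset%:R / n%:R)%:E.
Proof.
move=> n0; have Dn := card_minimizer n0.
have scale_gt0 : 0 < (Num.sqrt n%:R)^-1 :> R by rewrite invr_gt0 sqrtr_gt0 ltr0n.
have rescale_inj : injective (@rescale R n).
  move=> [a b] [c d] [] /(mulfI (lt0r_neq0 scale_gt0)) ->.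
  by move=> /(mulfI (lt0r_neq0 scale_gt0)) ->.
have [comp _] := D1_comp n0; have sub := component_sub comp.
rewrite /empirical_measure Dn.
rewrite (eq_bigr (fun x => ((x \in D1 n)%:R)%:E)); last first.
  move=> x _; rewrite diracE; congr ((_ : bool)%:R%:E).
  apply/idP/idP => [|xD]; last by rewrite inE; exists x.
  by rewrite inE => -[y /= yD /rescale_inj <-].
rewrite sumEFin -EFinM mulrC; congr ((_ / _)%:E).
rewrite -natr_sum; congr (_%:R); rewrite -card_fset_count; congr #|` _|%fset.
apply/fsetP => x; rewrite !inE /=; case xD1: (x \in D1 n); rewrite ?andbF // andbT.
by rewrite (fsubsetP sub).
Qed.

Lemma cvg_empirical_measure :
  (fun n => empirical_measure (D n) [set rescale n x | x in [set` D1 n]])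
    @ \oo --> 1%E.
Proof.
have eq_near : \forall n \near \oo,
    (#|` D1 n|%fset%:R / n%:R)%:E =
    empirical_measure (D n) [set rescale n x | x in [set` D1 n]].
  by exists 1%N => // n /= n0; rewrite empirical_measure_component.
apply: cvg_trans (near_eq_cvg eq_near) _.
apply: cvg_EFin; last exact: cvg_component_fraction.
by exists 0%N.
Qed.

End MassConcentration.

(** * The substrate wall *)

Section WallGeometry.
Local Open Scope classical_set_scope.
Local Open Scope ring_scope.
Context {R : realType}.
Variables (p q : nat) (xF : R * R) (eFS : R).
Hypotheses (p_gt0 : (0 < p)%N) (q_gt0 : (0 < q)%N).

Definition wall_site (j : int) : R * R := (q%:R / p%:R * j%:~R, 0).

Lemma wallP (a : R * R) : substrate_wall p q a <-> exists j, a = wall_site j.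
Proof.
split=> [[k /dvdzP[j ->] ->]|[j ->]].
  by exists j; rewrite /wall_site; congr (_, _); rewrite rmorphM /=; lra.
exists (j * q%:Z); first by apply/dvdzP; exists j.
by rewrite /wall_site; congr (_, _); rewrite rmorphM /=; lra.
Qed.

Lemma wall_site_inj : injective wall_site.
Proof.
move=> i j [] /mulfI e; apply: (intr_inj (R := R)); apply: e.
by rewrite mulf_neq0 // ?invr_eq0 pnatr_eq0 -lt0n.
Qed.

Lemma eucl_dist_ge0 (a b : R * R) : 0 <= eucl_dist a b.
Proof. exact: sqrtr_ge0. Qed.

Lemma eucl_dist_sqr (a b : R * R) :
  eucl_dist a b ^+ 2 = (a.1 - b.1) ^+ 2 + (a.2 - b.2) ^+ 2.
Proof. by rewrite sqr_sqrtr // addr_ge0 ?sqr_ge0. Qed.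

Lemma dist_wall_le (a : R * R) (i : int) :
  dist_pt_set a (substrate_wall p q) <= eucl_dist a (wall_site i).
Proof.
apply: ge_inf; first by exists 0 => _ [b _ <-]; exact: eucl_dist_ge0.
by exists (wall_site i) => //; apply/wallP; exists i.
Qed.

(** The wall being discrete, its distance to a point is attained: at one of the
    two wall sites enclosing the abscissa of the point. *)
Lemma dist_wall_attained (a : R * R) :
  exists j, dist_pt_set a (substrate_wall p q) = eucl_dist a (wall_site j).
Proof.
pose g : R := q%:R / p%:R.
have g0 : 0 < g by rewrite divr_gt0 // ltr0n.
pose f := Num.floor (a.1 / g).
have /andP[lo hi] := floor_itv (a.1 / g); rewrite -/f in lo hi.
have {}lo : g * f%:~R <= a.1 by rewrite mulrC -ler_pdivlMr.
have {}hi : a.1 <= g * (f + 1)%:~R by rewrite mulrC -ler_pdivrMr // ltW.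
have closer (i j : int) : (a.1 - g * i%:~R) ^+ 2 <= (a.1 - g * j%:~R) ^+ 2 ->
    eucl_dist a (wall_site i) <= eucl_dist a (wall_site j).
  by move=> le; rewrite /eucl_dist ler_wsqrtr //= lerD2r.
have nearest : exists j, forall i,
    eucl_dist a (wall_site j) <= eucl_dist a (wall_site i).
  have left i : i <= f -> eucl_dist a (wall_site f) <= eucl_dist a (wall_site i).
    rewrite -(ler_int R) => le; apply: closer.
    have := ler_wpM2l (ltW g0) le => le'.
    by rewrite ler_sqr ?nnegrE; lra.
  have right i : f < i ->
      eucl_dist a (wall_site (f + 1)) <= eucl_dist a (wall_site i).
    move=> fi; have : f + 1 <= i by lia.
    rewrite -(ler_int R) => le; apply: closer.
    have := ler_wpM2l (ltW g0) le => le'.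
    by rewrite -sqrrN -[leRHS]sqrrN ler_sqr ?nnegrE; lra.
  have [le|/ltW le] := leP (eucl_dist a (wall_site f)) (eucl_dist a (wall_site (f + 1))).
    exists f => i; have [/left //|/right] := leP i f.
    exact: le_trans.
  exists (f + 1) => i; have [/left|/right //] := leP i f.
  exact: le_trans.
have [j jmin] := nearest; exists j; apply/eqP; rewrite eq_le dist_wall_le /=.
apply: lb_le_inf.
  by exists (eucl_dist a (wall_site 0)), (wall_site 0) => //; apply/wallP; exists 0.
by move=> _ [b /wallP[i ->] <-].
Qed.

Hypothesis pq_coprime : coprime p q.
Hypothesis film_wall_dist :
  eFS <= dist_set_set (film_boundary xF) (substrate_wall p q).
Hypothesis xF_contact : film_contact p q eFS xF xF.
Hypothesis xF_above : ~ closure (@lower_half_plane R) xF.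

Lemma film_boundaryP (a : R * R) :
  film_boundary xF a <-> exists k, a = film_site xF (k, 0).
Proof.
by split=> -[k ->]; exists k; rewrite /film_site scale0r addr0.
Qed.

Lemma boundary_wall_dist (k j : int) :
  eFS <= eucl_dist (film_site xF (k, 0)) (wall_site j).
Proof.
apply: le_trans film_wall_dist _; apply: ge_inf.
  by exists 0 => _ [a [b [_ _ ->]]]; exact: eucl_dist_ge0.
exists (film_site xF (k, 0)), (wall_site j); split => //.
  by apply/film_boundaryP; exists k.
by apply/wallP; exists j.
Qed.

Lemma film_height_ge0 : 0 <= xF.2.
Proof.
rewrite leNgt; apply/negP => neg; apply: xF_above.
exact: subset_closure.
Qed.

(** Let [d] be the abscissa of [xF] relative to a wall site in contact with it.
    By Bezout, the abscissae of boundary sites relative to wall sites are exactly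
    the [d + t / p] with [t] an integer. As none is closer to 0 than [d], one has
    [|2 d p| <= 1], and a contact means [t = 0] or [t = - 2 d p]; the second case
    gives a nonzero integer [tau] only when [xF] is halfway, [2 d p = 1] or
    [2 d p = -1]. *)
Lemma contact_structure : exists (j0 tau : int) (d : R),
  [/\ tau = 0 \/ tau = 1 \/ tau = -1,
      forall k j : int, eucl_dist (film_site xF (k, 0)) (wall_site j) = eFS <->
        p%:Z * k - q%:Z * (j - j0) = 0 \/ p%:Z * k - q%:Z * (j - j0) = tau,
      d ^+ 2 <= 1 / 4 & eFS ^+ 2 = d ^+ 2 + xF.2 ^+ 2].
Proof.
have pR : 0 < p%:R :> R by rewrite ltr0n.
have p_neq0 : p%:R != 0 :> R by rewrite gt_eqF.
have xF0 : film_site xF (0, 0) = xF by rewrite film_siteE; case: xF => a b /=;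
  rewrite mul0r mul0r !addr0.
have [_] := xF_contact; have [j0 ->] := dist_wall_attained xF => eFSE.
pose d := xF.1 - q%:R / p%:R * j0%:~R.
have sqrE k j : eucl_dist (film_site xF (k, 0)) (wall_site j) ^+ 2 =
    (d + (p%:Z * k - q%:Z * (j - j0))%:~R / p%:R) ^+ 2 + xF.2 ^+ 2.
  rewrite eucl_dist_sqr film_siteE /= mul0r !mul0r !addr0 subr0; congr (_ ^+ 2 + _).
  rewrite rmorphB !rmorphM /= rmorphB /= /d mulrBl [p%:R * _]mulrC mulfK //.
  by lra.
have eFS_sqr : eFS ^+ 2 = d ^+ 2 + xF.2 ^+ 2.
  have := sqrE 0 j0; rewrite xF0 eFSE => ->.
  by rewrite mulr0 subrr mulr0 subrr mul0r addr0.
have eFS_ge0 : 0 <= eFS by rewrite -eFSE eucl_dist_ge0.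
have d_min (t : int) : d ^+ 2 <= (d + t%:~R / p%:R) ^+ 2.
  have /coprimezP[[u v] /= uv] : coprimez p%:Z q%:Z by rewrite coprimezE.
  have := boundary_wall_dist (t * u) (j0 - t * v).
  rewrite -(ler_sqr (R := R)) ?nnegrE ?eucl_dist_ge0 // sqrE eFS_sqr lerD2r.
  have -> // : p%:Z * (t * u) - q%:Z * (j0 - t * v - j0) = t.
  by rewrite -[RHS]mulr1 -uv; lia.
pose e := - (2 * d * p%:R).
have d_le (t : int) : 0 <= t%:~R * (t%:~R - e).
  have := d_min t; rewrite /e => le.
  have : 0 <= ((d + t%:~R / p%:R) ^+ 2 - d ^+ 2) * p%:R ^+ 2.
    by rewrite mulr_ge0 ?subr_ge0 ?sqr_ge0.
  have -> : ((d + t%:~R / p%:R) ^+ 2 - d ^+ 2) * p%:R ^+ 2 =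
      t%:~R * ((p%:R / p%:R) * (p%:R / p%:R) * t%:~R + 2 * d * p%:R * (p%:R / p%:R)).
    by lra.
  by rewrite mulfV // !mul1r mulr1 opprK.
have e1 : -1 <= e <= 1 by have := d_le 1; have := d_le (-1); rewrite rmorphN /=; lra.
have dE : d = - (e / p%:R / 2) by rewrite /e mulNr mulfK //; lra.
have contactP k j : eucl_dist (film_site xF (k, 0)) (wall_site j) = eFS <->
    p%:Z * k - q%:Z * (j - j0) = 0 \/ (p%:Z * k - q%:Z * (j - j0))%:~R = e.
  set t := p%:Z * k - _; have tE := sqrE k j; rewrite -/t in tE.
  have key : (d + t%:~R / p%:R) ^+ 2 - d ^+ 2 = t%:~R * (t%:~R - e) / p%:R ^+ 2.
    rewrite dE expr2 expr2 invfM; by lra.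
  split=> [dist|[t0|te]].
  - have : t%:~R * (t%:~R - e) / p%:R ^+ 2 = 0.
      by rewrite -key; move: tE; rewrite dist eFS_sqr; lra.
    move/eqP; rewrite mulf_eq0 invr_eq0 expf_eq0 (negPf p_neq0) orbF mulf_eq0.
    by rewrite intr_eq0 (subr_eq0 _ e) => /orP[/eqP|/eqP]; [left|right].
  - apply/eqP; rewrite -(eqrXn2 (n := 2)) ?eucl_dist_ge0 // tE eFS_sqr.
    by rewrite t0 mul0r addr0.
  - apply/eqP; rewrite -(eqrXn2 (n := 2)) ?eucl_dist_ge0 // tE eFS_sqr.
    move: key; rewrite te subrr mulr0 mul0r => /eqP; rewrite subr_eq0 => /eqP ->.
    by [].
have d4 : d ^+ 2 <= 1 / 4.
  have p1 : 1 <= p%:R :> R by rewrite ler1n.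
  have /andP[lo hi] : -1 <= 2 * d * p%:R <= 1 by rewrite /e in e1; lra.
  have d_hi : d <= 1 / 2.
    rewrite leNgt; apply/negP => lt; have d0 : 0 <= d by lra.
    by have := ler_wpM2l d0 p1; lra.
  have d_lo : - (1 / 2) <= d.
    rewrite leNgt; apply/negP => lt; have d0 : 0 <= - d by lra.
    by have := ler_wpM2l d0 p1; lra.
  have : 0 <= (1 / 2 - d) * (1 / 2 + d) by rewrite mulr_ge0; lra.
  by lra.
have [eint|enot] := pselect (e = 1 \/ e = -1).
  have [tau [tauE tau1]] : exists tau : int, e = tau%:~R /\ (tau = 1 \/ tau = -1).
    by case: eint => ->; [exists 1 | exists (-1)]; split=> //; [left | right].
  exists j0, tau, d; split => //; first by right.
  move=> k j; rewrite contactP tauE.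
  by split=> -[h|h]; [left|right; apply: (intr_inj (R := R))|left|right; rewrite h].
exists j0, 0, d; split => //; first by left.
move=> k j; rewrite contactP; split=> [[->|te]|[->|->]]; try by left.
left; set t := p%:Z * k - _ in te *.
have : -1 <= t <= 1 by rewrite -!(ler_int R) te.
have : t <> 1 by move=> t1; apply: enot; left; rewrite -te t1.
have : t <> -1 by move=> t1; apply: enot; right; rewrite -te t1.
by lia.
Qed.

End WallGeometry.

(** * Arithmetic of contact sites *)

Section Residues.
Local Open Scope ring_scope.

Lemma dvdz_small (q : nat) (t : int) : (q%:Z %| t)%Z -> `|t| < q%:Z -> t = 0.
Proof.
move=> /dvdzP[m ->]; have [->|m0] := eqVneq m 0; first by rewrite mul0r.
have m1 : 0 <= (`|m| - 1) * q%:Z by rewrite mulr_ge0 //; lia.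
by rewrite normrM; lia.
Qed.

Variables (p q : nat) (tau : int).

Definition touches (k : int) : bool :=
  (q%:Z %| p%:Z * k)%Z || (q%:Z %| p%:Z * k - tau)%Z.

Lemma touchesP (j0 k : int) : reflect
  (exists j, p%:Z * k - q%:Z * (j - j0) = 0 \/ p%:Z * k - q%:Z * (j - j0) = tau)
  (touches k).
Proof.
apply: (iffP orP) => [[/dvdzP[m e]|/dvdzP[m e]]|[j [e|e]]].
- by exists (m + j0); left; lia.
- by exists (m + j0); right; lia.
- by left; apply/dvdzP; exists (j - j0); lia.
- by right; apply/dvdzP; exists (j - j0); lia.
Qed.

Lemma isolated_contacts (sigma : nat) (k : int) :
    (forall k, touches k = (q%:Z %| k)%Z || (q%:Z %| k - sigma%:Z)%Z) ->
    (1 < q)%N -> (sigma < q)%N -> sigma != 1%N -> sigma.+1 != q ->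
  touches k -> touches (k + 1) -> False.
Proof.
move=> sE q1 sq s1 sq1; rewrite !sE.
by case/orP=> h1; case/orP=> h2; have := rpredB h2 h1;
  set t := _ - _ => /dvdz_small h; (have: t = 0 by apply: h; rewrite /t; lia);
  rewrite /t; lia.
Qed.

Lemma paired_contacts (sigma : nat) (k : int) :
    (forall k, touches k = (q%:Z %| k)%Z || (q%:Z %| k - sigma%:Z)%Z) ->
    (2 < q)%N ->
  touches k -> touches (k + 1) -> touches (k + 2) -> False.
Proof.
move=> sE q2; rewrite !sE.
have clash (a b : int) : (q%:Z %| a)%Z -> (q%:Z %| b)%Z -> 0 < b - a < q%:Z -> False.
  by move=> ha hb ab; have := dvdz_small (rpredB hb ha); lia.
by case/orP=> h1; case/orP=> h2; case/orP=> h3;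
  first [ apply: (clash _ _ h1 h2); lia | apply: (clash _ _ h2 h3); lia
        | apply: (clash _ _ h1 h3); lia ].
Qed.

Hypotheses (q_gt0 : (0 < q)%N) (pq_coprime : coprime p q).

(** As [p] is invertible modulo [q], the contact sites form at most two residue
    classes, one of them that of 0. *)
Lemma touches_residues : exists sigma : nat, [/\ (sigma < q)%N,
  forall k, touches k = (q%:Z %| k)%Z || (q%:Z %| k - sigma%:Z)%Z &
  (q%:Z %| p%:Z * sigma%:Z - tau)%Z].
Proof.
have cop : coprimez q%:Z p%:Z by rewrite coprimezE coprime_sym.
have /coprimezP[[v u] /= uv] := cop.
have q_neq0 : q%:Z != 0 by lia.
have s0 := modz_ge0 (tau * u) q_neq0.
have sq := ltz_pmod (tau * u) (q_gt0 : 0 < q%:Z).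
have sE := divz_eq (tau * u) q%:Z.
move: (tau * u %% q%:Z)%Z (tau * u %/ q%:Z)%Z s0 sq sE => s m s0 sq sE.
have e : p%:Z * s - tau = (- (tau * v) - p%:Z * m) * q%:Z.
  have -> : s = tau * u - m * q%:Z by rewrite sE addrAC subrr add0r.
  by rewrite -[X in _ - X = _]mulr1 -uv; lia.
have dv : (q%:Z %| p%:Z * s - tau)%Z by rewrite e dvdz_mull.
exists (absz s); have -> : (absz s)%:Z = s by lia.
split=> //; first by lia.
move=> k; rewrite /touches (Gauss_dvdzr k cop); congr (_ || _).
have -> : p%:Z * k - tau = p%:Z * (k - s) + (p%:Z * s - tau) by lia.
by rewrite rpredDr // (Gauss_dvdzr _ cop).
Qed.

Lemma touches_periodic k : touches (k + q%:Z) = touches k.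
Proof.
have shift t : (q%:Z %| t + q%:Z)%Z = (q%:Z %| t)%Z by rewrite rpredDr ?dvdzz.
by have [s [_ sE _]] := touches_residues; rewrite !sE addrAC !shift.
Qed.

Lemma residue_gt0 (s : nat) : (1 < q)%N -> tau = 1 \/ tau = -1 ->
  (q%:Z %| p%:Z * s%:Z - tau)%Z -> (0 < s)%N.
Proof.
move=> q1 tau1; case: s => //; rewrite mulr0 sub0r => /dvdz_small.
by clear -q1 tau1; case: tau1 => ->; lia.
Qed.

(** Otherwise [s] would divide [q], hence [tau], so that [s = 1] and [q = 2]. *)
Lemma residue_not_half (s : nat) : (2 < q)%N -> tau = 1 \/ tau = -1 ->
  (q%:Z %| p%:Z * s%:Z - tau)%Z -> q <> (2 * s)%N.
Proof.
move=> q2 tau1 dv qs; have : (s%:Z %| tau)%Z.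
  rewrite -[tau](subKr (p%:Z * s%:Z)) rpredB ?dvdz_mull // (dvdz_trans _ dv) //.
  by rewrite qs PoszM dvdz_mull.
by clear -q2 qs tau1 => /dvdz_small; case: tau1 => ->; lia.
Qed.

Lemma residue_inner (s : nat) (k : int) : (s < q)%N -> 0 < k < q%:Z ->
  (q%:Z %| k)%Z || (q%:Z %| k - s%:Z)%Z -> k = s%:Z.
Proof.
move=> sq kq; clear -sq kq => /orP[/dvdz_small|/dvdz_small] k0;
  by have := k0 ltac:(lia); lia.
Qed.

End Residues.

(** * Substrate neighbors and substrate energy *)

Section SubstrateNeighbors.
Local Open Scope classical_set_scope.
Local Open Scope ring_scope.
Context {R : realType}.
Variables (p q : nat) (xF : R * R) (eFS cS : R).
Hypotheses (p_gt0 : (0 < p)%N) (q_gt0 : (0 < q)%N) (eFS_gt0 : 0 < eFS).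
Hypothesis film_wall_dist :
  eFS <= dist_set_set (film_boundary xF) (substrate_wall p q).
Hypothesis xF_above : ~ closure (@lower_half_plane R) xF.
Variables (j0 tau : int) (d : R).
Hypothesis contactP : forall k j : int,
  eucl_dist (film_site xF (k, 0)) (wall_site p q j) = eFS <->
    p%:Z * k - q%:Z * (j - j0) = 0 \/ p%:Z * k - q%:Z * (j - j0) = tau.
Hypothesis d_le : d ^+ 2 <= 1 / 4.
Hypothesis eFS_sqr : eFS ^+ 2 = d ^+ 2 + xF.2 ^+ 2.

(** The rows above the boundary are too high to touch the wall: the offset of a
    contact is at most 1/2, and one row rises by more than that. *)
Lemma upper_row_far (k i j : int) : 0 < i ->
  eFS < eucl_dist (film_site xF (k, i)) (wall_site p q j).
Proof.
move=> i0; rewrite -(ltr_pXn2r (n := 2)) ?nnegrE ?eucl_dist_ge0 ?(ltW eFS_gt0) //.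
rewrite eucl_dist_sqr eFS_sqr film_siteE /= subr0.
set s : R := Num.sqrt 3; have ss : s ^+ 2 = 3 by rewrite sqr_sqrtr.
have s0 : 0 <= s by rewrite sqrtr_ge0.
have i1 : 1 <= i%:~R :> R by rewrite -[1]/(1%:~R) ler_int; lia.
have Y0 := film_height_ge0 xF_above.
have x0 := sqr_ge0 (xF.1 + k%:~R + i%:~R / 2 - q%:R / p%:R * j%:~R).
set X := (_ ^+ 2) in x0 *.
have y0 : 0 <= xF.2 * (i%:~R * s) by rewrite !mulr_ge0 //; lra.
have z0 : 3 <= i%:~R ^+ 2 * s ^+ 2.
  rewrite ss; have : 1 <= i%:~R ^+ 2 :> R by rewrite exprn_ege1.
  by lra.
by move: d_le; lra.
Qed.

Lemma film_wall_far (x : int * int) (j : int) : 0 <= x.2 ->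
  eFS <= eucl_dist (film_site xF x) (wall_site p q j).
Proof.
case: x => k i /=; rewrite le_eqVlt => /orP[/eqP<-|/upper_row_far far].
  exact: boundary_wall_dist.
exact: ltW.
Qed.

Lemma v1_neighbors (x : int * int) : 0 <= x.2 ->
  v1 p q eFS cS (film_site xF x) =
    (\sum_(a \in substrate_neighbors p q eFS (film_site xF x)) (- cS)%:E)%E.
Proof.
move=> x0; rewrite /v1; symmetry.
rewrite (eq_fsbigr (fun a => vFS eFS cS (eucl_dist (film_site xF x) a))); last first.
  by move=> a; rewrite inE => -[_ dist]; rewrite /vFS /sticky dist ltxx eqxx.
apply: fsbig_widen => [a [] //|a [wall notN]] /=.
have /wallP[j aE] := wall.
have far := film_wall_far j x0; rewrite -aE in far.
rewrite /vFS /sticky ltNge far /=; case: eqP => // dist.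
by case: notN; split.
Qed.

Lemma upper_row_substrate_energy (k i : int) : 0 < i ->
  v1 p q eFS cS (film_site xF (k, i)) = 0%E.
Proof.
move=> i0; rewrite v1_neighbors ?ltW // (_ : substrate_neighbors _ _ _ _ = set0).
  by rewrite fsbig_set0.
rewrite -subset0 => a [/wallP[j ->] dist].
by have := upper_row_far k j i0; rewrite dist ltxx.
Qed.

Lemma neighbors_single (k j : int) :
    (forall j', p%:Z * k - q%:Z * (j' - j0) = 0 \/
                p%:Z * k - q%:Z * (j' - j0) = tau <-> j' = j) ->
  substrate_neighbors p q eFS (film_site xF (k, 0)) = [set wall_site p q j].
Proof.
move=> only; apply/seteqP; split=> [a [/wallP[i ->] /contactP/only ->]//|_ ->].
by split; [apply/wallP; exists j | apply/contactP/only].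
Qed.

(** A boundary site has at most one substrate neighbor unless [q = 1] and the
    film sits halfway between two wall sites. *)
Lemma substrate_energy_single (x : int * int) :
    [\/ tau = 0 | (1 < q)%N /\ (tau = 1 \/ tau = -1)] -> 0 <= x.2 ->
  v1 p q eFS cS (film_site xF x)
    = (- (cS * ((x.2 == 0) && touches p q tau x.1)%:R))%:E.
Proof.
move=> single; case: x => k i /=; have [->|i0] := eqVneq i 0; last first.
  rewrite le_eqVlt eq_sym (negPf i0) /= => /upper_row_substrate_energy ->.
  by rewrite mulr0 oppr0.
move=> _; rewrite v1_neighbors //; case: (touchesP p q tau j0 k) => [[j jE]|no] /=.
  rewrite (neighbors_single (j := j)) ?fsbig_set1 ?mulr1 // => j'.
  split=> [j'E|->//]; nia.
rewrite (_ : substrate_neighbors _ _ _ _ = set0) ?fsbig_set0 ?mulr0 ?oppr0 //.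
rewrite -subset0 => a [/wallP[j ->] /contactP h].
by apply: no; exists j.
Qed.

Lemma neighbors_pair (k : int) : q = 1%N ->
  substrate_neighbors p q eFS (film_site xF (k, 0)) =
    [set wall_site p q (j0 + p%:Z * k)] `|` [set wall_site p q (j0 + p%:Z * k - tau)].
Proof.
clear -contactP => q1; apply/seteqP; split=> [a [/wallP[i ->] /contactP h]|a].
  by case: h => h; [left|right]; congr wall_site; lia.
by move=> [->|->]; split; (try by apply/wallP; eexists);
  apply/contactP; rewrite q1; [left|right]; lia.
Qed.

Lemma substrate_energy_pair (x : int * int) : q = 1%N -> tau != 0 -> 0 <= x.2 ->
  v1 p q eFS cS (film_site xF x) = (- (2 * cS * ((x.2 == 0) && true)%:R))%:E.
Proof.
move=> q1 tau0; case: x => k i /=; have [->|i0] := eqVneq i 0; last first.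
  rewrite le_eqVlt eq_sym (negPf i0) /= => /upper_row_substrate_energy ->.
  by rewrite mulr0 oppr0.
move=> _; rewrite v1_neighbors // neighbors_pair // fsbigU0; first last.
- move=> a [-> /(wall_site_inj p_gt0 q_gt0) e]; move/eqP: tau0; apply; lia.
- exact: finite_set1.
- exact: finite_set1.
by rewrite !fsbig_set1 /= mulr1; congr (_%:E); lra.
Qed.

Lemma film_contactP (k : int) :
  film_contact p q eFS xF (film_site xF (k, 0)) <-> touches p q tau k.
Proof.
split=> [[_ dist]|/(touchesP p q tau j0)[j /contactP jE]].
  have [j jE] := dist_wall_attained p_gt0 q_gt0 (film_site xF (k, 0)).
  by apply/(touchesP p q tau j0); exists j; apply/contactP; rewrite -jE.
split; first by apply/film_boundaryP; exists k.
apply/eqP; rewrite eq_le; apply/andP; split.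
  by rewrite -jE; apply: dist_wall_le.
have [i ->] := dist_wall_attained p_gt0 q_gt0 (film_site xF (k, 0)).
exact: boundary_wall_dist.
Qed.

Lemma segment_point (t : R) :
  (1 - t) *: xF + t *: (xF + q%:R *: t1) = (xF.1 + t * q%:R, xF.2).
Proof.
apply/pair_equal_spec; split.
  by rewrite /= -![_ *: _]/(_ * _); lra.
by rewrite /= -![_ *: _]/(_ * _); lra.
Qed.

Lemma inner_contactsP (a : R * R) : inner_contacts p q eFS xF a <->
  exists k : int, [/\ 0 < k < q%:Z, touches p q tau k & a = film_site xF (k, 0)].
Proof.
have qR : 0 < q%:R :> R by rewrite ltr0n.
have rowE (k : int) : film_site xF (k, 0) = (xF.1 + k%:~R, xF.2).
  by rewrite film_siteE /= !mul0r !addr0.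
split=> [[[t /andP[t0 t1] aE] contact]|[k [/andP[k0 kq] kt ->]]]; last first.
  split; last exact/film_contactP.
  exists (k%:~R / q%:R).
    rewrite /= divr_gt0 ?ltr0z //= ltr_pdivrMr // mul1r.
    by rewrite -(ltr_int R) in kq.
  by rewrite segment_point divfK ?rowE // gt_eqF.
have [/film_boundaryP[k kE] _] := contact.
exists k; split=> //; last by apply/film_contactP; rewrite -kE.
move: aE; rewrite kE rowE segment_point => -[/addrI kt].
rewrite -!(ltr_int R) -kt mulr_gt0 //=.
by rewrite gtr_pMl.
Qed.

End SubstrateNeighbors.

(** * The four classes *)

Section ContactModel.
Local Open Scope classical_set_scope.
Local Open Scope ring_scope.

Lemma card_set2 (T : choiceType) (a b : T) : a != b -> ([set a] `|` [set b] #= `I_2)%card.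
Proof.
move=> ab; rewrite (_ : _ `|` _ = [set` [fset a; b]%fset]).
  by apply/card_eq_fsetP; rewrite cardfs2 ab.
apply/seteqP; split=> x /=; rewrite !inE; first by case=> ->; rewrite eqxx ?orbT.
by case/orP=> /eqP; [left|right].
Qed.

(** Each class forces one shape of the contact pattern. Two neighbors at [xF]
    happen only for [q = 1], where every site then has energy [- 2 cS]; here the
    dewetting condition [cS < 4 cF] does not exclude [2 cS >= 4 cF], whence the
    second alternative of the conclusion. The third class forces [q = 2], and
    all sites are contacts. In the fourth, contacts come in adjacent pairs when
    [s] is 1 or [q - 1], and are isolated otherwise. *)
Lemma contact_model (R : realType) (p q : nat) (xF : R * R) (eFS cF cS : R) :
    0 < eFS -> 0 < cF -> 0 < cS -> (0 < p)%N -> (0 < q)%N -> coprime p q ->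
    ~ closure (@lower_half_plane R) xF ->
    eFS <= dist_set_set (film_boundary xF) (substrate_wall p q) ->
    film_contact p q eFS xF xF -> dewetting p q xF eFS cF cS ->
  exists (beta : R) (w : pred int),
    [/\ 0 <= beta, forall a, w (a + q%:Z) = w a,
        forall x : int * int, 0 <= x.2 ->
          v1 p q eFS cS (film_site xF x) = (- (beta * ((x.2 == 0) && w x.1)%:R))%:E
      & segments_costly cF beta w \/ (4 * cF <= beta /\ forall a, w a)].
Proof.
move=> eFS0 cF0 cS0 p0 q0 cop above wall_dist contact [dew1 dew2 dew3].
have [j0 [tau [d [tau3 contactP d_le eFS_sqr]]]] :=
  contact_structure p0 q0 cop wall_dist contact.
have xF0 : film_site xF (0, 0) = xF.
  by rewrite film_siteE /= !mul0r !addr0 -surjective_pairing.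
have innerP := inner_contactsP p0 q0 wall_dist contactP.
have energy1 := substrate_energy_single cS p0 q0 eFS0 wall_dist above contactP d_le eFS_sqr.
have single : [\/ tau = 0 | (1 < q)%N /\ (tau = 1 \/ tau = -1)] ->
    (substrate_neighbors p q eFS xF #= `I_1)%card.
  move=> tau1; rewrite -xF0 (neighbors_single contactP (j := j0)) ?card_set1 // => j'.
  rewrite mulr0; split=> [|->]; last by left; lia.
  by nia.
have per : forall a, touches p q tau (a + q%:Z) = touches p q tau a.
  by move=> a; apply: touches_periodic.
have [tau0|tau0] := eqVneq tau 0.
  have sing : [\/ tau = 0 | (1 < q)%N /\ (tau = 1 \/ tau = -1)] by left.
  have touchE k : touches p q tau k = (q%:Z %| k)%Z.
    rewrite /touches tau0 subr0 orbb Gauss_dvdzr // coprimezE coprime_sym //.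
  have c2 : class2 p q eFS xF.
    split; first exact: single.
    rewrite -subset0 => a /innerP[k [kq + _]]; rewrite touchE => qk.
    have k0 : k = 0 by apply: (residue_inner q0 kq); rewrite qk.
    by rewrite k0 ltxx in kq.
  exists cS, (touches p q tau); split => //; first exact: ltW.
    by move=> x; apply: energy1.
  left; have [q1|q1] := eqVneq q 1%N.
    by apply: dense_segments_costly => //; [exact: ltW | apply: dew3; left; split=> //; right].
  have q2 : (1 < q)%N by rewrite ltn_neqAle eq_sym q1.
  apply: isolated_segments_costly => //; first exact: ltW.
    by apply: dew1; apply: Or31; split=> //; right.
  move=> a; apply: (isolated_contacts (sigma := 0)) => //.
  - by move=> k; rewrite subr0 orbb touchE.
  - by rewrite eq_sym.
have {tau3}tau1 : tau = 1 \/ tau = -1.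
  by case: tau3 => // tau00; rewrite tau00 eqxx in tau0.
have [q1|q1] := eqVneq q 1%N.
  have c1 : class1 p q eFS xF.
    rewrite /class1 -xF0 (neighbors_pair contactP) //; apply: card_set2.
    apply: contraNneq tau0 => /(wall_site_inj p0 q0)/eqP.
    by rewrite eq_sym subr_eq -[X in X == _]addr0 (inj_eq (addrI _)) eq_sym.
  have cS4 : cS < 4 * cF by apply: dew3; left; split=> //; left.
  exists (2 * cS), predT; split => //; first by lra.
    move=> x x0.
    exact: (substrate_energy_pair cS p0 q0 eFS0 wall_dist above contactP d_le eFS_sqr).
  have [le|lt] := leP (4 * cF) (2 * cS); first by right.
  by left; apply: dense_segments_costly => //; lra.
have q2 : (1 < q)%N by rewrite ltn_neqAle eq_sym q1.
have sing : [\/ tau = 0 | (1 < q)%N /\ (tau = 1 \/ tau = -1)] by right.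
have [s [sq touchE dv]] := touches_residues tau q0 cop.
have s0 : (0 < s)%N := residue_gt0 q2 tau1 dv.
have innerE : inner_contacts p q eFS xF = [set xF + s%:R *: t1].
  have sE : xF + s%:R *: t1 = film_site xF (s%:Z, 0).
    by rewrite /film_site scale0r addr0.
  apply/seteqP; split=> [a /innerP[k [kq]]|_ ->]; rewrite sE.
    by rewrite touchE => /(residue_inner sq kq) -> ->.
  apply/innerP; exists s%:Z; split => //; first by rewrite !ltz_nat s0.
  by rewrite touchE subrr dvdz0 orbT.
exists cS, (touches p q tau); split => //; first exact: ltW.
  by move=> x; apply: energy1.
left; have [q22|q22] := eqVneq q 2%N.
  have s1 : s = 1%N by apply/eqP; rewrite eqn_leq s0 -ltnS -q22 sq.
  apply: dense_segments_costly; [by []|exact: ltW|]. apply: dew3; right; split=> //.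
  split; first exact: single.
  by rewrite innerE s1 q22 divff // pnatr_eq0.
have q3 : (2 < q)%N by rewrite ltn_neqAle eq_sym q22.
have s_half : s%:R != q%:R / 2 :> R.
  apply/eqP => h; apply: (residue_not_half q3 tau1 dv).
  by apply/eqP; rewrite -(eqr_nat R) natrM h mulrC divfK // pnatr_eq0.
have sq1 : (s <= q - 1)%N by rewrite subn1 -ltnS prednK.
have c4 : class4_with p q eFS xF s.
  by split => //; [exact: single | rewrite s0].
have [s_end|s_mid] := boolP ((s == 1%N) || (s.+1 == q)).
  apply: paired_segments_costly => //; first exact: ltW.
    apply: dew2; exists s => //; case/orP: s_end => /eqP sE; first by left.
    by right; rewrite -sE subn1.
  by move=> a; apply: (paired_contacts touchE).
move: s_mid; rewrite negb_or => /andP[s1 s2].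
apply: isolated_segments_costly => //; first exact: ltW.
  apply: dew1; apply: Or33; exists s => //.
  by rewrite ltn_neqAle eq_sym s1 s0 ltn_subRL add1n ltn_neqAle s2.
by move=> a; apply: (isolated_contacts touchE).
Qed.

End ContactModel.

Unset Implicit Arguments.
Local Open Scope classical_set_scope.
Local Open Scope ring_scope.

Theorem theorem2p4 (R : realType) (p q : nat) (xF : R * R) (eFS cF cS : R)
    (eFS_gt0 : 0 < eFS) (cF_gt0 : 0 < cF) (cS_gt0 : 0 < cS)
    (p_gt0 : (0 < p)%N) (q_gt0 : (0 < q)%N) (pq_coprime : coprime p q)
    (xF_above : ~ closure (@lower_half_plane R) xF)
    (film_wall_dist :
       eFS <= dist_set_set (film_boundary xF) (substrate_wall p q))
    (xF_contact : film_contact p q eFS xF xF)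
    (dewet : dewetting p q xF eFS cF cS)
    (D D1 : nat -> {fset R * R})
    (D_min : forall n, (0 < n)%N -> is_minimizer p q xF eFS cF cS n (D n))
    (D1_comp : forall n, (0 < n)%N -> is_largest_component (D n) (D1 n)) :
  (fun n => empirical_measure (D n) [set rescale n x | x in [set` D1 n]])
    @ \oo --> 1%E
  /\
  (fun n => #|` D1 n|%:R / n%:R : R) @ \oo --> (1 : R).
Proof.
have [beta [w [beta_ge0 w_periodic energy_w dichotomy]]] :=
  contact_model eFS_gt0 cF_gt0 cS_gt0 p_gt0 q_gt0 pq_coprime xF_above
    film_wall_dist xF_contact dewet.
split.
  exact: (cvg_empirical_measure energy_w cF_gt0 beta_ge0 q_gt0 w_periodic
            dichotomy D_min D1_comp).
exact: (cvg_component_fraction energy_w cF_gt0 beta_ge0 q_gt0 w_periodic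
          dichotomy D_min D1_comp).
Qed.
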